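(* Let $B$ be a (not necessarily thick) spherical building of type $A_n$, and let $C\subset B$ be a convex subcomplex. Then either $C$ is a subbuilding of $B$, or $C$ has circumradius $\operatorname{rad}(C)\leq \frac{\pi}{2}$.
   Context: A spherical Coxeter complex $(S,W)$ is a unit round sphere $S=S^n\subset\mathbb{R}^{n+1}$ with a finite group $W$ of isometries generated by reflections in linear hyperplanes; walls are fixed spheres of reflections in $W$, Weyl chambers are closures of components of the complement of the walls, faces are intersections of chambers with intersections of walls, roots are hemispheres bounded by walls. A spherical building modelled on $(S,W)$ is a CAT(1) space $B$ with an atlas of isometric embeddings $S\hookrightarrow B$ (whose images are called apartments) such that any two points of $B$ lie in a common apartment, the atlas is closed under precomposition with elements of $W$, and coordinate changes are restrictions of elements of $W$; walls, chambers, faces, roots of $B$ are the images of those of $S$. The building is of type $A_n$ if $(S,W)$ is the Coxeter complex of the root system $A_n$. A subset $C\subset B$ is convex if for all $x,y\in C$ with $d(x,y)<\pi$ the geodesic segment $xy$ lies in $C$; a convex subcomplex is a convex subset which is a union of faces. A subbuilding is a convex subset $B'\subset B$ such that any two points of $B'$ lie in a convex sphere $s\subset B'$ with $\dim s=\dim B'$. The circumradius of $C$ is $\operatorname{rad}(C)=\inf_{y\in C}\sup_{x\in C}d(x,y)$. *)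

(* Defs.v *)
From HB Require Import structures.
From mathcomp Require Import all_boot all_order all_algebra all_fingroup.
From mathcomp Require Import all_classical all_reals all_analysis.
Set Implicit Arguments. Unset Strict Implicit. Unset Printing Implicit Defensive.
Import Order.TTheory GRing.Theory Num.Theory.
Local Open Scope classical_set_scope.
Local Open Scope ring_scope.

Section Defs.
Variable R : realType.

Definition dotv (m : nat) (x y : 'rV[R]_m) : R := \sum_(i < m) x ord0 i * y ord0 i.

Definition usphere (m : nat) : set 'rV[R]_m := [set x | dotv x x = 1].
Arguments usphere : clear implicits.

Definition sdist (m : nat) (x y : 'rV[R]_m) : R := acos (dotv x y).

Definition is_metric (B : Type) (d : B -> B -> R) : Prop :=
  [/\ forall x, d x x = 0,
      forall x y, d x y = 0 -> x = y,
      forall x y, d x y = d y x &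
      forall x y z, d x z <= d x y + d y z].

Definition geodesic (B : Type) (d : B -> B -> R) (p q : B) (gam : R -> B) : Prop :=
  [/\ gam 0 = p, gam (d p q) = q &
      forall s t, 0 <= s <= d p q -> 0 <= t <= d p q -> d (gam s) (gam t) = `|s - t| ].

Definition geod_segment (B : Type) (d : B -> B -> R) (p q : B) (gam : R -> B) : set B :=
  gam @` [set t | 0 <= t <= d p q].

(* The point at arc length t on the great circle arc from a to b in S^2. *)
Definition arc_point (a b : 'rV[R]_3) (t : R) : 'rV[R]_3 :=
  let L := sdist a b in
  if L == 0 then a else (sin L)^-1 *: (sin (L - t) *: a + sin t *: b).

(* CAT(1): pi-geodesic, and every geodesic triangle of perimeter < 2 pi
   satisfies the CAT(1) comparison inequality (for two points on two sides
   issuing from a common vertex p; all pairs of points of a triangle are of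
   this form after relabelling the vertices). *)
Definition CAT1 (B : Type) (d : B -> B -> R) : Prop :=
  is_metric d /\
  (forall p q, d p q < pi -> exists gam, geodesic d p q gam) /\
  (forall p q r (g1 g2 : R -> B) (pb qb rb : 'rV[R]_3),
      d p q + d q r + d r p < 2 * pi ->
      geodesic d p q g1 -> geodesic d p r g2 ->
      usphere 3 pb -> usphere 3 qb -> usphere 3 rb ->
      sdist pb qb = d p q -> sdist qb rb = d q r -> sdist rb pb = d r p ->
      forall s t, 0 <= s <= d p q -> 0 <= t <= d p r ->
      d (g1 s) (g2 t) <= sdist (arc_point pb qb s) (arc_point pb rb t)).

(* Model: the unit sphere S^(n-1) of the hyperplane {sum x_i = 0} of R^(n+1),
   with W = S_(n+1) acting by permuting coordinates. *)
Definition SA (n : nat) : set 'rV[R]_(n.+1) :=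
  [set x | usphere (n.+1) x /\ \sum_(i < n.+1) x ord0 i = 0].
Arguments SA : clear implicits.

Definition Wact (n : nat) (w : 'S_(n.+1)) (x : 'rV[R]_(n.+1)) : 'rV[R]_(n.+1) :=
  \row_i x ord0 (w i).

Definition wallA (n : nat) (i j : 'I_(n.+1)) : set 'rV[R]_(n.+1) :=
  [set x | SA n x /\ Wact (tperm i j) x = x].

(* The Weyl chambers (closures of the components of the complement of the
   walls): x_(w 0) >= x_(w 1) >= ... >= x_(w n). *)
Definition chamberA (n : nat) (w : 'S_(n.+1)) : set 'rV[R]_(n.+1) :=
  [set x | SA n x /\ forall i j : 'I_(n.+1), (i <= j)%N -> x ord0 (w j) <= x ord0 (w i)].

Definition faceA (n : nat) (F : set 'rV[R]_(n.+1)) : Prop :=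
  exists (w : 'S_(n.+1)) (P : {set 'I_(n.+1) * 'I_(n.+1)}),
    (forall ij, ij \in P -> ij.1 != ij.2) /\
    F = [set x | chamberA w x /\ forall ij, ij \in P -> wallA ij.1 ij.2 x].
Arguments faceA : clear implicits.

(* (B, d) with atlas A of charts S -> B. *)
Definition building_An (n : nat) (B : Type) (d : B -> B -> R)
    (A : set ('rV[R]_(n.+1) -> B)) : Prop :=
  [/\ CAT1 d,
      forall f, A f -> forall x y, SA n x -> SA n y -> d (f x) (f y) = sdist x y,
      forall p q : B, exists f, A f /\ exists x y, [/\ SA n x, SA n y, f x = p & f y = q],
      forall f (w : 'S_(n.+1)), A f -> A (f \o Wact w) &
      forall f g, A f -> A g -> exists w : 'S_(n.+1),
        forall x y, SA n x -> SA n y -> f x = g y -> y = Wact w x].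
Arguments building_An : clear implicits.

Definition face_of (n : nat) (B : Type) (A : set ('rV[R]_(n.+1) -> B)) (F : set B) : Prop :=
  exists f F0, A f /\ faceA n F0 /\ F = f @` F0.

Definition convex_set (B : Type) (d : B -> B -> R) (C : set B) : Prop :=
  forall x y gam, C x -> C y -> d x y < pi -> geodesic d x y gam ->
    geod_segment d x y gam `<=` C.

Definition convex_subcomplex (n : nat) (B : Type) (d : B -> B -> R)
    (A : set ('rV[R]_(n.+1) -> B)) (C : set B) : Prop :=
  convex_set d C /\ forall x, C x -> exists F, face_of A F /\ F x /\ F `<=` C.

Definition sphere_dim (B : Type) (d : B -> B -> R) (s : set B) (k : nat) : Prop :=
  exists phi : 'rV[R]_(k.+1) -> B,
    (forall x y, usphere (k.+1) x -> usphere (k.+1) y -> d (phi x) (phi y) = sdist x y) /\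
    s = phi @` usphere (k.+1).

Definition dim_ge (B : Type) (d : B -> B -> R) (X : set B) (k : nat) : Prop :=
  exists (c : 'rV[R]_(k.+1)) (e : R) (phi : 'rV[R]_(k.+1) -> B),
    let ball := [set x | usphere (k.+1) x /\ sdist x c < e] in
    [/\ 0 < e, usphere (k.+1) c,
        (forall x y, ball x -> ball y -> d (phi x) (phi y) = sdist x y) &
        phi @` ball `<=` X].

Definition is_dim (B : Type) (d : B -> B -> R) (X : set B) (k : nat) : Prop :=
  dim_ge d X k /\ ~ dim_ge d X k.+1.

Definition subbuilding (B : Type) (d : B -> B -> R) (B' : set B) : Prop :=
  convex_set d B' /\
  forall x y, B' x -> B' y -> exists (s : set B) (k : nat),
    [/\ s `<=` B', convex_set d s, sphere_dim d s k, s x /\ s y &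
        is_dim d B' k].

Definition circumradius (B : Type) (d : B -> B -> R) (C : set B) : \bar R :=
  ereal_inf [set ereal_sup [set (d x y)%:E | x in C] | y in C].

End Defs.

Arguments usphere {R} m.
Arguments SA {R} n.
Arguments faceA {R} n F.
Arguments building_An {R} n {B} d A.

(* Main.v *)
Require Import Defs.
From HB Require Import structures.
From mathcomp Require Import all_boot all_order all_algebra all_fingroup.
From mathcomp Require Import all_classical all_reals all_analysis.
From mathcomp Require Import ring lra.
(* The names shared by finset and classical_sets refer to finite sets below. *)
From mathcomp Require Import fintype finset.
Set Implicit Arguments. Unset Strict Implicit. Unset Printing Implicit Defensive.
Import Order.TTheory GRing.Theory Num.Theory.
Import numFieldNormedType.Exports.
Local Open Scope ring_scope.

(* The cone over B is treated like the set of R-filtrations of a vector space: a chart sends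
   a vector v of R^(n+1) to a filtration, and the vertices of C, with a zero and a one, form
   a modular lattice L, graded by dimension, because inner products with a fixed vertex are
   concave along geodesics.
   If L is complemented, two points of C lie in generic filtrations v, w of a common chart; splitting off
   complements along v produces a filtration opposite to v, adapted to w, and the chart
   through both has all its level blocks in C, which gives an apartment of C.
   If not, call v graded when its subquotients over weight intervals of length < 1 are
   complemented. Complementedness of modular intervals passes to joins, so v + w is graded
   whenever v is graded and w is any filtration in C. As L itself is not complemented, graded
   filtrations have norm bounded below; an (almost) shortest one, y, satisfies
   |y + t x|^2 >= |y|^2 (up to epsilon) for all x in C and t > 0, that is <x, y> >= 0, so C
   lies in the ball of radius pi/2 about y. The construction is the weight filtration of
   Haiden, Katzarkov, Kontsevich and Pandit. *)

(** * Complements in modular lattices *)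

(** The axioms put two points into a common chart, never three, and [B] need not come from a vector
    space, so the lattice has to be extracted from the metric. Two devices make pairs suffice. A
    chain of subspaces is encoded as a single point of the cone whose closed face contains the whole
    chain, so a chain and one more subspace share a chart; and comparison with a third subspace is
    read off from inner products. Both need charts that agree at a point to agree on its closed
    face. The axioms only say that coordinates of common points differ by a permutation; agreement
    follows from discreteness of the orbits of [W] along an arc. The extra line factor turns every
    subset of coordinates into a 0/1 vector, so that inner products count dimensions of
    intersections. Length one in the notion of a graded filtration fixes a scale: stretching a
    generic filtration makes it graded, shrinking destroys this in general, so minimising the norm
    makes sense. [C] need not be compact, hence an almost shortest filtration for each error; the
    circumradius, an infimum, absorbs the error. *)

Record modular_lattice (T : Type) (le : T -> T -> Prop) (mt jn : T -> T -> T) : Prop := {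
  ml_refl : forall a, le a a;
  ml_anti : forall a b, le a b -> le b a -> a = b;
  ml_trans : forall b a c, le a b -> le b c -> le a c;
  mt_lbl : forall a b, le (mt a b) a;
  mt_lbr : forall a b, le (mt a b) b;
  mt_glb : forall a b c, le c a -> le c b -> le c (mt a b);
  jn_ubl : forall a b, le a (jn a b);
  jn_ubr : forall a b, le b (jn a b);
  jn_lub : forall a b c, le a c -> le b c -> le (jn a b) c;
  modular_le : forall a b c, le a c -> le (mt (jn a b) c) (jn a (mt b c)) }.

Definition complemented (T : Type) (le : T -> T -> Prop) (mt jn : T -> T -> T) (a b : T) :=
  forall c, le a c -> le c b -> exists2 c', mt c c' = a & jn c c' = b.

Section Modular.
Variables (T : Type) (le : T -> T -> Prop) (mt jn : T -> T -> T).
Hypothesis L : modular_lattice le mt jn.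
Local Notation cpl := (complemented le mt jn).
Let lrefl := ml_refl L.
Let lmt1 := mt_lbl L.
Let lmt2 := mt_lbr L.
Let ljn1 := jn_ubl L.
Let ljn2 := jn_ubr L.
Let lglb := mt_glb L.
Let llub := jn_lub L.
Local Hint Resolve lrefl lmt1 lmt2 ljn1 ljn2 : core.

Lemma le_mtl a b c : le a c -> le (mt a b) c. Proof. by move=> h; apply: (ml_trans L) h. Qed.
Lemma le_mtr a b c : le b c -> le (mt a b) c. Proof. by move=> h; apply: (ml_trans L) h. Qed.
Lemma le_jnl a b c : le a b -> le a (jn b c). Proof. by move=> h; apply: (ml_trans L) h _. Qed.
Lemma le_jnr a b c : le a c -> le a (jn b c). Proof. by move=> h; apply: (ml_trans L) h _. Qed.
Local Hint Resolve le_mtl le_mtr le_jnl le_jnr lglb llub : core.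

(** By the modular law a complement [u] of [c] in the large interval can be cut down to the small
    one as [mt (jn a' u) b']. *)
Lemma complemented_sub a b a' b' : cpl a b -> le a a' -> le a' b' -> le b' b -> cpl a' b'.
Proof.
move=> cab aa ab bb c ac cb.
case: (cab c); [exact: (ml_trans L aa ac)|exact: (ml_trans L cb bb)|move=> u cu cu'].
have ub : le u b by rewrite -cu'.
have au : le a u by rewrite -cu.
exists (mt (jn a' u) b'); apply: (ml_anti L); auto.
- apply: (ml_trans L (b := mt (jn a' u) c)); first by auto.
  apply: (ml_trans L (modular_le L u ac)); apply: (jn_lub L) => //.
  by apply: (ml_trans L) aa; rewrite -cu; auto.
- apply: (ml_trans L (b := mt (jn c (jn a' u)) b')).
    apply: (mt_glb L) => //; apply: (ml_trans L bb); rewrite -cu'; auto.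
  exact: (modular_le L).
Qed.

(** Dedekind's transposition principle: joining with [a] maps [[mt a b, b]] isomorphically onto
    [[a, jn a b]], and meeting with [b] is the inverse. The next lemma is the other direction. *)
Lemma complemented_up a b : cpl (mt a b) b -> cpl a (jn a b).
Proof.
move=> h c ac cb; case: (h (mt c b)); [by apply: (mt_glb L); auto; apply: le_mtl|by auto|].
move=> u cu cu'; have ub : le u b by rewrite -cu'.
exists (jn a u); apply: (ml_anti L); auto.
- apply: (ml_trans L (b := mt (jn a u) c)); first by auto.
  apply: (ml_trans L (modular_le L u ac)); apply: (jn_lub L) => //.
  by apply: (ml_trans L (b := mt a b)); auto; rewrite -cu; auto 6.
- apply: (jn_lub L); first by auto.
  by rewrite -{1}cu'; apply: (jn_lub L); auto.
Qed.

Lemma complemented_down a b : cpl a (jn a b) -> cpl (mt a b) b.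
Proof.
move=> h c ac cb; case: (h (jn c a)); [by auto|by auto|].
move=> u cu cu'; have au : le a u by rewrite -cu; auto.
exists (mt u b); apply: (ml_anti L); auto.
- by apply: (mt_glb L); auto; rewrite -[X in le _ X]cu; auto 6.
- apply: (ml_trans L (b := mt (jn c u) b)); last exact: (modular_le L).
  apply: (mt_glb L) => //; apply: (ml_trans L (b := jn a b)) => //.
  by rewrite -cu'; apply: (jn_lub L); auto; apply: (jn_lub L); auto.
Qed.

(* A complement of [c] in the join is assembled from one of [c /\ b] in [[a, b]]
   and one of [c \/ b] in [[b, b \/ b']], the latter lifted to meet [b] in [a]. *)
Lemma complemented_jn a b b' : le a b -> le a b' -> cpl a b -> cpl a b' -> cpl a (jn b b').
Proof.
move=> ab ab' hb hb' c ac cb.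
case: (hb (mt c b)); [by auto|by auto|move=> u cu cu'].
have ub : le u b by rewrite -cu'.
have au : le a u by rewrite -cu.
have hbb : cpl b (jn b b') by apply/complemented_up/(complemented_sub hb'); auto.
case: (hbb (jn c b)); [by auto|by auto|move=> v cv cv'].
have bv : le b v by rewrite -cv.
have vb : le v (jn b b') by rewrite -cv'; auto.
have hv : cpl a (mt v b') by apply: (complemented_sub hb'); auto; apply: (mt_glb L); auto; apply: (ml_trans L _ bv).
case: (hv (mt b b')); [by auto|by apply: (mt_glb L); auto; apply: le_mtl|move=> w cw cw'].
have wv : le w (mt v b') by rewrite -cw'; auto.
have aw : le a w by rewrite -cw.
have wv' : le w v by apply: (ml_trans L wv).
have wb' : le w b' by apply: (ml_trans L wv).
have vw : le v (jn b w).
  apply: (ml_trans L (b := mt (jn b b') v)); first by auto.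
  apply: (ml_trans L (modular_le L b' bv)); apply: (jn_lub L); auto.
  apply: (ml_trans L (b := mt v b')); first by auto.
  by rewrite -cw'; apply: (jn_lub L); auto.
have bw : le (mt b w) a.
  by rewrite -[X in le _ X]cw; apply: (mt_glb L); auto.
exists (jn u w); apply: (ml_anti L); auto.
- have zb : le (mt c (jn u w)) b.
    rewrite -[X in le _ X]cv; apply: (mt_glb L); first by auto.
    by apply: le_mtr; apply: (jn_lub L); auto; apply: (ml_trans L _ bv).
  have zu : le (mt c (jn u w)) u.
    apply: (ml_trans L (b := mt (jn u w) b)); first by auto.
    apply: (ml_trans L (modular_le L w ub)); apply: (jn_lub L) => //.
    by apply: (ml_trans L (b := mt b w)); auto; apply: (ml_trans L bw).
  by rewrite -[X in le _ X]cu; apply: (mt_glb L); auto.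
- have hb1 : le b (jn c (jn u w)).
    by rewrite -{1}cu'; apply: (jn_lub L); auto.
  have hv1 : le v (jn c (jn u w)).
    by apply: (ml_trans L vw); apply: (jn_lub L); auto.
  by rewrite -{1}cv'; apply: (jn_lub L); auto; apply: (jn_lub L); auto.
Qed.
End Modular.

(** * Great circle arcs *)

Section Dot.
Variables (R : realType) (m : nat).
Implicit Types x y z : 'rV[R]_m.

Lemma dotvC x y : dotv x y = dotv y x.
Proof. by apply: eq_bigr => i _; rewrite mulrC. Qed.

Lemma dotvDl x y z : dotv (x + y) z = dotv x z + dotv y z.
Proof. by rewrite -big_split; apply: eq_bigr => i _; rewrite mxE mulrDl. Qed.

Lemma dotvZl a x y : dotv (a *: x) y = a * dotv x y.
Proof. by rewrite mulr_sumr; apply: eq_bigr => i _; rewrite mxE mulrA. Qed.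

Lemma dotvDr x y z : dotv x (y + z) = dotv x y + dotv x z.
Proof. by rewrite dotvC dotvDl !(dotvC x). Qed.

Lemma dotvZr a x y : dotv x (a *: y) = a * dotv x y.
Proof. by rewrite dotvC dotvZl dotvC. Qed.

Lemma dotv_ge0 x : 0 <= dotv x x.
Proof. by apply: sumr_ge0 => i _; rewrite -expr2 sqr_ge0. Qed.

Lemma dotv_eq0 x : dotv x x = 0 -> x = 0.
Proof.
move=> /eqP; rewrite psumr_eq0; last by move=> i _; rewrite -expr2 sqr_ge0.
move=> /allP h; apply/rowP => i; rewrite mxE.
by have := h i (mem_index_enum _); rewrite /= mulf_eq0 orbb => /eqP.
Qed.

Lemma unit_dotv_bounds x y : usphere m x -> usphere m y -> -1 <= dotv x y <= 1.
Proof.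
rewrite /usphere /= => hx hy.
have h1 := dotv_ge0 (x + y); have h2 := dotv_ge0 (x + (-1) *: y).
rewrite !(dotvDl, dotvDr, dotvZl, dotvZr) hx hy (dotvC y x) in h1 h2.
by apply/andP; split; lra.
Qed.

Lemma unit_dotv1 x y : usphere m x -> usphere m y -> dotv x y = 1 -> x = y.
Proof.
rewrite /usphere /= => hx hy h.
have /dotv_eq0 /eqP : dotv (x + (-1) *: y) (x + (-1) *: y) = 0.
  by rewrite !(dotvDl, dotvDr, dotvZl, dotvZr) hx hy (dotvC y x) h; ring.
by rewrite scaleN1r subr_eq0 => /eqP.
Qed.

Lemma unit_dotvN1 x y : usphere m x -> usphere m y -> dotv x y = -1 -> y = - x.
Proof.
rewrite /usphere /= => hx hy h.
have /dotv_eq0 /eqP : dotv (y + x) (y + x) = 0.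
  by rewrite !(dotvDl, dotvDr) hx hy (dotvC y x) h; ring.
by rewrite addr_eq0 => /eqP.
Qed.

Lemma cos_sdist x y : usphere m x -> usphere m y -> cos (sdist x y) = dotv x y.
Proof. by move=> hx hy; rewrite acosK// in_itv/= unit_dotv_bounds. Qed.

Lemma sdist_bounds x y : usphere m x -> usphere m y -> 0 <= sdist x y <= pi.
Proof.
by move=> hx hy; have h := unit_dotv_bounds hx hy; rewrite acos_ge0// acos_lepi.
Qed.

Lemma sdist_eq x y (t : R) : 0 <= t <= pi -> dotv x y = cos t -> sdist x y = t.
Proof. by move=> ht h; rewrite /sdist h cosK// in_itv. Qed.

Lemma sdistxx x : usphere m x -> sdist x x = 0.
Proof. by rewrite /sdist /usphere /= => ->; rewrite acos1. Qed.

Lemma cos_lt (a b : R) : 0 <= a <= pi -> 0 <= b <= pi -> cos a < cos b -> b < a.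
Proof. by move=> ha hb; rewrite ltr_cos// in_itv/=. Qed.

Lemma cos_le (a b : R) : 0 <= a <= pi -> 0 <= b <= pi -> a <= b -> cos b <= cos a.
Proof.
move=> ha hb hab; rewrite leNgt; apply/negP => h.
by have := cos_lt ha hb h; rewrite ltNge hab.
Qed.

(** Spherical linear interpolation: for distinct, non-antipodal unit vectors, the unit speed arc
    from [x] that reaches [y] at time [sdist x y]. *)
Definition great_arc x y (t : R) :=
  (sin (sdist x y))^-1 *: (sin (sdist x y - t) *: x + sin t *: y).

Lemma dotv_great_arc x y s t : usphere m x -> usphere m y -> 0 < sdist x y < pi ->
  dotv (great_arc x y s) (great_arc x y t) = cos (s - t).
Proof.
move=> hx hy hxy; have c := cos_sdist hx hy.
have sn0 : sin (sdist x y) != 0 by rewrite gt_eqF// sin_gt0_pi.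
rewrite /great_arc; move: (sdist x y) c sn0 => L c sn0.
rewrite !(dotvDl, dotvDr, dotvZl, dotvZr) (dotvC y x) -c hx hy !sinB cosB.
have e : cos L ^+ 2 = 1 - sin L ^+ 2 by rewrite cos2sin2.
move: sn0 e; move: (sin L) (cos L) (sin s) (cos s) (sin t) (cos t) => a b p q u v a0 e.
transitivity (a^-1 * a^-1 * (a * a * q * v + p * u * (1 - b ^+ 2))); first by ring.
rewrite e; by field.
Qed.

Lemma usphere_great_arc x y t : usphere m x -> usphere m y -> 0 < sdist x y < pi ->
  usphere m (great_arc x y t).
Proof. by move=> *; rewrite /usphere /= dotv_great_arc// subrr cos0. Qed.

Lemma great_arc0 x y : 0 < sdist x y < pi -> great_arc x y 0 = x.
Proof.
move=> h; rewrite /great_arc subr0 sin0 scale0r addr0 scalerA mulVf ?scale1r//.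
by rewrite gt_eqF// sin_gt0_pi.
Qed.

Lemma great_arc_end x y : 0 < sdist x y < pi -> great_arc x y (sdist x y) = y.
Proof.
move=> h; rewrite /great_arc subrr sin0 scale0r add0r scalerA mulVf ?scale1r//.
by rewrite gt_eqF// sin_gt0_pi.
Qed.

Lemma sdist_great_arc x y s t : usphere m x -> usphere m y -> 0 < sdist x y < pi ->
  0 <= s <= sdist x y -> 0 <= t <= sdist x y ->
  sdist (great_arc x y s) (great_arc x y t) = `|s - t|.
Proof.
move=> hx hy hxy /andP[s0 s1] /andP[t0 t1]; case/andP: (hxy) => L0 L1.
apply: sdist_eq; last by rewrite dotv_great_arc// cos_norm.
rewrite normr_ge0 ler_norml; apply/andP; split; lra.
Qed.

(** The time is [sdist x z], whose cosine and sine are computed from [a] and [b]; it cannot exceed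
    [sdist x y], since [a] would then be negative. *)
Lemma great_arcP x y z (a b : R) : usphere m x -> usphere m y -> 0 < sdist x y < pi ->
  0 <= a -> 0 <= b -> z = a *: x + b *: y -> usphere m z ->
  exists2 t, 0 <= t <= sdist x y & z = great_arc x y t /\
    sin (sdist x y - t) = a * sin (sdist x y) /\ sin t = b * sin (sdist x y).
Proof.
move=> hx hy hxy a0 b0 ez hz; have c := cos_sdist hx hy.
have s0 : 0 < sin (sdist x y) by rewrite sin_gt0_pi.
case/andP: hxy => L0 L1.
have ct : cos (sdist x z) = a + b * cos (sdist x y).
  by rewrite cos_sdist// ez dotvDr !dotvZr c hx mulr1.
have st : sin (sdist x z) = b * sin (sdist x y).
  apply/eqP; rewrite -(@eqrXn2 _ 2)// ?sin_ge0_pi ?sdist_bounds//; last first.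
    by rewrite mulr_ge0// ltW.
  have e : dotv z z = 1 by [].
  rewrite ez !(dotvDl, dotvDr, dotvZl, dotvZr) hx hy (dotvC y x) -c in e.
  by rewrite exprMn !sin2cos2 ct; apply/eqP; rewrite -[X in X - _]e; ring.
have st2 : sin (sdist x y - sdist x z) = a * sin (sdist x y).
  by rewrite sinB ct st; ring.
exists (sdist x z); last split=> //.
  have /andP[t0 t1] := sdist_bounds hx hz; rewrite t0 /= leNgt; apply/negP => ltt.
  have : 0 < sin (sdist x z - sdist x y) by apply: sin_gt0_pi; apply/andP; split; lra.
  rewrite -opprB sinN st2 oppr_gt0 ltNge mulr_ge0//; exact: ltW.
rewrite /great_arc st st2 !(mulrC _ (sin _)) -!scalerA -scalerDr scalerA mulVf ?scale1r//.
by rewrite gt_eqF.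
Qed.
End Dot.

(** * Charts agree on closed faces *)

Lemma cos_near1 (R : realType) (g : R) : 0 < g ->
  exists2 e : R, 0 < e & forall t, 0 <= t < e -> 1 - g < cos t.
Proof.
move=> g0; have := @continuous_cos R 0.
rewrite /continuous_at cos0 => /cvgr_gt /(_ (1 - g)).
rewrite gtrBl => /(_ g0) /nbhs_ballP [e /= e0 he]; exists e => // t /andP[t0 te].
by apply: he; rewrite /ball /= sub0r normrN ger0_norm.
Qed.

Lemma gap (R : realType) (m : nat) (v : 'rV[R]_m) :
  exists2 g : R, 0 < g & forall i j, v ord0 i < v ord0 j -> g <= v ord0 j - v ord0 i.
Proof.
exists (\big[Order.min/1]_(p : 'I_m * 'I_m | v ord0 p.1 < v ord0 p.2) (v ord0 p.2 - v ord0 p.1)).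
  by apply: lt_bigmin => // p; rewrite subr_gt0.
by move=> i j h; rewrite (bigmin_le_cond 1 (j := (i, j)) (P := fun p => v ord0 p.1 < v ord0 p.2) (fun p => v ord0 p.2 - v ord0 p.1)).
Qed.

Section Coarse.
Variables (R : realType) (m : nat).
Implicit Types v w : 'rV[R]_m.

(* [v'] lies, up to a multiple of (1, ..., 1), in the closed face spanned by [v]. *)
Definition coarse v v' := forall i j, v ord0 i <= v ord0 j -> v' ord0 i <= v' ord0 j.

Lemma coarse_refl v : coarse v v. Proof. by []. Qed.

Lemma coarse_eq v v' i j : coarse v v' -> v ord0 i = v ord0 j -> v' ord0 i = v' ord0 j.
Proof. by move=> h e; apply/eqP; rewrite eq_le !h// e. Qed.

Lemma coarse_lt v v' i j : coarse v v' -> v' ord0 i < v' ord0 j -> v ord0 i < v ord0 j.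
Proof. by move=> h; rewrite !ltNge; apply: contra => /h. Qed.
End Coarse.

Section Perm.
Variables (R : realType) (n : nat).
Local Notation V := 'rV[R]_(n.+1).
Implicit Types (u v w x : V) (s : 'S_(n.+1)).

Lemma WactE s v i : Wact s v ord0 i = v ord0 (s i).
Proof. by rewrite /Wact mxE. Qed.

Lemma Wact_dotv s v w : dotv (Wact s v) (Wact s w) = dotv v w.
Proof.
rewrite /dotv [RHS](reindex_inj (@perm_inj _ s)) /=.
by apply: eq_bigr => i _; rewrite !WactE.
Qed.

Lemma Wact_sum s v : \sum_i Wact s v ord0 i = \sum_i v ord0 i.
Proof. by rewrite [RHS](reindex_inj (@perm_inj _ s)); apply: eq_bigr => i _; rewrite WactE. Qed.

Lemma Wact_SA s v : SA n v -> SA n (Wact s v).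
Proof. by case=> h1 h2; split; rewrite ?Wact_sum// /usphere /= Wact_dotv. Qed.

Lemma WactD s v w : Wact s (v + w) = Wact s v + Wact s w.
Proof. by apply/rowP => i; rewrite !(WactE, mxE). Qed.

Lemma WactZ s a v : Wact s (a *: v) = a *: Wact s v.
Proof. by apply/rowP => i; rewrite !(WactE, mxE). Qed.

Lemma Wact_const s (c : R) : Wact s (const_mx c) = const_mx c.
Proof. by apply/rowP => i; rewrite !(WactE, mxE). Qed.

Lemma Wact1 v : Wact 1%g v = v.
Proof. by apply/rowP => i; rewrite WactE perm1. Qed.

Lemma WactM s t v : Wact s (Wact t v) = Wact (s * t)%g v.
Proof. by apply/rowP => i; rewrite !WactE permM. Qed.

Lemma Wact_coarse s v w : coarse v w -> coarse (Wact s v) (Wact s w).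
Proof. by move=> h i j; rewrite !WactE; apply: h. Qed.

Lemma SA_lt x : SA n x -> exists i j, x ord0 i < x ord0 j.
Proof.
case=> x1 x0; apply: contrapT => h.
have hc i : x ord0 i = x ord0 ord0.
  by apply/eqP; rewrite eq_le !leNgt; apply/andP; split; apply/negP => hi; apply: h; do 2 eexists; exact: hi.
have e0 : x ord0 ord0 = 0.
  move: x0; rewrite (eq_bigr _ (fun i _ => hc i)) sumr_const card_ord => /eqP.
  by rewrite mulrn_eq0 /= => /eqP.
move: x1; rewrite /usphere /= /dotv big1; last by move=> i _; rewrite hc e0 mulr0.
by move=> /eqP; rewrite eq_sym oner_eq0.
Qed.

Lemma SA_great_arc x y t : SA n x -> SA n y -> 0 < sdist x y < pi -> SA n (great_arc x y t).
Proof.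
move=> [hx x0] [hy y0] hxy; split; first exact: usphere_great_arc.
rewrite /great_arc; under eq_bigr do rewrite !mxE.
by rewrite -mulr_sumr big_split /= -!mulr_sumr x0 y0 !mulr0 addr0 mulr0.
Qed.

Lemma coarse_not_opp x z : SA n x -> coarse x z -> z <> - x.
Proof.
move=> hx hz ez; case: (SA_lt hx) => i [j ij].
by have := hz _ _ (ltW ij); rewrite ez !mxE lerN2 leNgt ij.
Qed.

Lemma sdist_lt_pi x z : SA n x -> SA n z -> z <> - x -> sdist x z < pi.
Proof.
move=> [hx _] [hz _] h; apply: acos_ltpi; have /andP[h1 ->] := unit_dotv_bounds hx hz.
rewrite andbT lt_neqAle h1 andbT; apply/eqP => e; apply: h.
exact: unit_dotvN1.
Qed.

Lemma sdist_gt0 x z : SA n x -> SA n z -> x <> z -> 0 < sdist x z.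
Proof.
move=> [hx _] [hz _] h; apply: acos_gt0; have /andP[-> h1] := unit_dotv_bounds hx hz.
by rewrite /= lt_neqAle h1 andbT; apply/eqP => e; apply: h; apply: unit_dotv1.
Qed.

(** Before time [sdist x z] the coefficient of [x] is positive, so every strict inequality between
    coordinates of [x] persists: the arc leaves the open face of [x] at most at its end. *)
Lemma coarse_great_arc x z t : 0 < sdist x z < pi -> 0 <= t < sdist x z -> coarse x z ->
  coarse x (great_arc x z t) /\ coarse (great_arc x z t) x.
Proof.
move=> hxz /andP[t0 tL] hz; case/andP: (hxz) => L0 L1.
have s0 : 0 < (sin (sdist x z))^-1 by rewrite invr_gt0 sin_gt0_pi.
have s1 : 0 < sin (sdist x z - t) by apply: sin_gt0_pi; apply/andP; split; lra.
have s2 : 0 <= sin t by apply: sin_ge0_pi; apply/andP; split; lra.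
split=> i j h.
  by rewrite /great_arc !mxE ler_pM2l// lerD// ler_wpM2l// ?(ltW s1)//; apply: hz.
rewrite leNgt; apply/negP => h'; move: h; rewrite leNgt => /negP; apply.
by rewrite /great_arc !mxE ltr_pM2l// ltr_leD// ?ltr_pM2l// ler_wpM2l//; apply/hz/ltW.
Qed.
End Perm.

Section Building.
Variables (R : realType) (n : nat) (B : Type) (d : B -> B -> R).
Variable A : set ('rV[R]_(n.+1) -> B).
Hypothesis bld : building_An n d A.
Local Notation V := 'rV[R]_(n.+1).
Implicit Types (f g h : V -> B) (u v w x y z : V) (s : 'S_(n.+1)).

Lemma dist_triangle p q r : d p r <= d p q + d q r.
Proof. by case: bld => -[[_ _ _ h] _] *; apply: h. Qed.

Lemma dist_sym p q : d p q = d q p.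
Proof. by case: bld => -[[_ _ h _] _] *; apply: h. Qed.

Lemma dist_eq0 p q : d p q = 0 -> p = q.
Proof. by case: bld => -[[_ h _ _] _] *; apply: h. Qed.

Lemma distxx p : d p p = 0.
Proof. by case: bld => -[[h _ _ _] _] *; apply: h. Qed.

Lemma chart_isom f x y : A f -> SA n x -> SA n y -> d (f x) (f y) = sdist x y.
Proof. by case: bld => _ h _ _ _ Af; apply: h. Qed.

Lemma chart_Wact f s : A f -> A (f \o Wact s).
Proof. by case: bld => _ _ _ h _; apply: h. Qed.

Lemma common_chart p q : exists2 f, A f & exists x y, [/\ SA n x, SA n y, f x = p & f y = q].
Proof. by case: bld => _ _ /(_ p q) [f [Af h]] _ _; exists f. Qed.

Lemma chart_change f g : A f -> A g ->
  exists s, forall x y, SA n x -> SA n y -> f x = g y -> y = Wact s x.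
Proof. by case: bld => _ _ _ _ h; apply: h. Qed.

Lemma dist_bounds p q : 0 <= d p q <= pi.
Proof.
case: (common_chart p q) => f Af [x [y [hx hy <- <-]]].
by rewrite chart_isom//; apply: sdist_bounds; [case: hx|case: hy].
Qed.

(* The coordinates in a third chart of [f a] and [g a] lie in one [W]-orbit, hence
   are equal or a definite distance apart. *)
Lemma chart_step f g x (gam : R) : A f -> A g -> SA n x -> 0 < gam ->
  (forall i j, x ord0 i < x ord0 j -> gam <= x ord0 j - x ord0 i) ->
  1 - gam ^+ 2 / 2 < cos (d (f x) (g x)) -> f x = g x.
Proof.
move=> Af Ag hx g0 hgap hd.
case: (common_chart (f x) (g x)) => h Ah [p [q [hp hq ep eq]]].
case: (chart_change Af Ah) => s /(_ x p hx hp (esym ep)) e1.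
case: (chart_change Ag Ah) => t /(_ x q hx hq (esym eq)) e2.
rewrite -ep -eq; congr h; apply: contrapT => npq.
have [i hi] : exists i, p ord0 i != q ord0 i.
  apply: contrapT => hh; apply: npq; apply/rowP => i; apply/eqP/negPn/negP => hi.
  by apply: hh; exists i.
(* Both numbers are coordinates of [x], so they differ by at least [gam]. As [|p - q|^2] is
   [2 - 2 cos d], this is the origin of the threshold [1 - gam ^+ 2 / 2]. *)
have : gam ^+ 2 <= (p ord0 i - q ord0 i) ^+ 2.
  rewrite -[X in _ <= X]real_normK ?num_real// ler_sqr ?nnegrE// ?(ltW g0)//.
  rewrite e1 e2 !WactE in hi *.
  by case: (ltgtP (x ord0 (s i)) (x ord0 (t i))) hi => // h' _; 
    [rewrite distrC|]; rewrite ger0_norm ?hgap// subr_ge0 ltW.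
have : (p ord0 i - q ord0 i) ^+ 2 <= dotv (p - q) (p - q).
  rewrite /dotv (bigD1 i)//= !mxE -expr2 lerDl; apply: sumr_ge0 => k _.
  by rewrite -expr2 sqr_ge0.
move: hd; rewrite -ep -eq chart_isom// cos_sdist//; [|by case: hp|by case: hq].
have -> : p - q = p + (-1) *: q by rewrite scaleN1r.
rewrite !(dotvDl, dotvDr, dotvZl, dotvZr) (dotvC q p).
have [[-> _] [-> _]] : SA n p /\ SA n q by [].
by lra.
Qed.

(** Walk along the arc from [x] to [z] in steps so short that [chart_step] carries agreement from
    one point to the next; this needs one coordinate gap valid on the whole arc. *)
Lemma chart_open_face f g x z : A f -> A g -> SA n x -> SA n z -> f x = g x ->
  coarse x z -> coarse z x -> f z = g z.
Proof.
move=> Af Ag hx hz e cxz czx.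
have [->//|/eqP nxz] := eqVneq z x.
have hL : 0 < sdist x z < pi.
  by rewrite sdist_gt0 ?sdist_lt_pi//; [exact: coarse_not_opp|by move=> /esym].
have [hx1 _] := hx; have [hz1 _] := hz.
case: (gap x) => g1 g10 hg1; case: (gap z) => g2 g20 hg2.
pose gm := Order.min g1 g2.
have gm0 : 0 < gm by rewrite lt_min g10.
have L0 : 0 < sdist x z by case/andP: hL.
have hgap t : 0 <= t <= sdist x z ->
    forall i j, great_arc x z t ord0 i < great_arc x z t ord0 j -> gm <= great_arc x z t ord0 j - great_arc x z t ord0 i.
  move=> /andP[t0 tL] i j hij.
  have s1 : 0 <= sin (sdist x z - t).
    by case/andP: hL => L1 L2; apply: sin_ge0_pi; apply/andP; split; lra.
  have s2 : 0 <= sin t by case/andP: hL => L1 L2; apply: sin_ge0_pi; apply/andP; split; lra.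
  have sL : 0 < sin (sdist x z) by exact: sin_gt0_pi.
  have xij : x ord0 i < x ord0 j.
    rewrite ltNge; apply/negP => h; move: hij; rewrite ltNge => /negP; apply.
    rewrite /great_arc !mxE ler_wpM2l ?invr_ge0 ?(ltW sL)// lerD// ler_wpM2l//.
    exact: cxz.
  have h1 : gm <= x ord0 j - x ord0 i by rewrite ge_min hg1.
  have h2 : gm <= z ord0 j - z ord0 i.
    by rewrite ge_min hg2 ?orbT//; apply: coarse_lt xij.
  rewrite /great_arc !mxE -mulrBr mulrC ler_pdivlMr//.
  have -> : sin (sdist x z - t) * x ord0 j + sin t * z ord0 j
    - (sin (sdist x z - t) * x ord0 i + sin t * z ord0 i)
    = sin (sdist x z - t) * (x ord0 j - x ord0 i) + sin t * (z ord0 j - z ord0 i) by ring.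
  apply: le_trans (_ : sin (sdist x z - t) * gm + sin t * gm <= _); last first.
    by rewrite lerD// ler_wpM2l.
  (* The coefficients of an arc of length [L] add up to at least one:
     [sin (L - t) + sin t >= sin L]. *)
  rewrite -mulrDl mulrC ler_wpM2r ?(ltW gm0)//.
  have := sinD (sdist x z - t) t; rewrite subrK => ->.
  by apply: lerD; [apply: ler_piMr|apply: ler_piMl]; rewrite ?cos_le1.
case: (@cos_near1 R (gm ^+ 2 / 2)); first by rewrite divr_gt0// exprn_gt0.
move=> e0 e00 he0.
(* The factor 2 pays for going back along [f] and forth along [g] through the previous point, where
   the charts agree. *)
pose M := (Num.truncn (2 * sdist x z / Order.min e0 pi)).+1.
have me : 0 < Order.min e0 pi by rewrite lt_min e00 pi_gt0.
have M0 : 0 < M%:R :> R by rewrite ltr0n.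
have hM : 2 * (sdist x z / M%:R) < Order.min e0 pi.
  rewrite mulrA ltr_pdivrMr// [ltRHS]mulrC -ltr_pdivrMr//.
  exact: truncnS_gt.
have step (k : nat) : (k <= M)%N -> f (great_arc x z (k%:R * (sdist x z / M%:R))) = g (great_arc x z (k%:R * (sdist x z / M%:R))).
  have hk (j : nat) : (j <= M)%N -> 0 <= j%:R * (sdist x z / M%:R) <= sdist x z.
    move=> jM; rewrite mulr_ge0 ?divr_ge0//= ?(ltW L0) ?(ltW M0)//.
    by rewrite mulrA ler_pdivrMr// mulrC ler_wpM2l ?(ltW L0) ?ler_nat.
  elim: k => [_|k IH kM]; first by rewrite mul0r great_arc0.
  have kM' := ltnW kM; have ek := IH kM'.
  have hs t : SA n (great_arc x z t) by exact: SA_great_arc.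
  apply: (@chart_step f g _ gm) => //; first by apply: hgap; apply: hk.
  apply: he0; case/andP: (dist_bounds (f (great_arc x z (k.+1%:R * (sdist x z / M%:R))))
     (g (great_arc x z (k.+1%:R * (sdist x z / M%:R))))) => -> _ /=.
  apply: le_lt_trans (dist_triangle _ (f (great_arc x z (k%:R * (sdist x z / M%:R)))) _) _.
  rewrite {2}ek !chart_isom// !sdist_great_arc ?hk//.
  rewrite (distrC (k%:R * _)) -mulrBl -natrB// subSnn mul1r ger0_norm; last first.
    by rewrite divr_ge0 ?(ltW L0) ?(ltW M0).
  by apply: lt_le_trans (_ : Order.min e0 pi <= _); [lra|rewrite ge_min lexx].
have := step M (leqnn _).
by rewrite mulrCA divff ?mulr1 ?gt_eqF// great_arc_end.
Qed.

(** Agreement on the open face extends to [z] by continuity: an arc point [e0] before [z] is at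
    distance [e0] from both [f z] and [g z], and [e0 <= d (f z) (g z) / 3] contradicts the triangle
    inequality. *)
Lemma chart_face f g x z : A f -> A g -> SA n x -> SA n z -> f x = g x ->
  coarse x z -> f z = g z.
Proof.
move=> Af Ag hx hz e cxz.
have [->//|/eqP nxz] := eqVneq z x.
have hL : 0 < sdist x z < pi.
  by rewrite sdist_gt0 ?sdist_lt_pi//; [exact: coarse_not_opp|by move=> /esym].
have [hx1 _] := hx; have [hz1 _] := hz.
have L0 : 0 < sdist x z by case/andP: hL.
apply: dist_eq0; apply/eqP; rewrite eq_le; case/andP: (dist_bounds (f z) (g z)) => -> _.
rewrite andbT leNgt; apply/negP => dp.
pose e0 := Order.min (sdist x z) (d (f z) (g z) / 3).
have e00 : 0 < e0 by rewrite lt_min L0 divr_gt0.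
have eL : e0 <= sdist x z by rewrite ge_min lexx.
have ed : e0 <= d (f z) (g z) / 3 by rewrite ge_min lexx orbT.
have ht : 0 <= sdist x z - e0 < sdist x z by apply/andP; split; lra.
have [c1 c2] := coarse_great_arc hL ht cxz.
have hs : SA n (great_arc x z (sdist x z - e0)) by exact: SA_great_arc.
have ea := chart_open_face Af Ag hx hs e c1 c2.
have h1 : sdist (great_arc x z (sdist x z - e0)) (great_arc x z (sdist x z)) = e0.
  rewrite sdist_great_arc//; [|by apply/andP; split; lra|by apply/andP; split; lra].
  by rewrite addrAC subrr add0r normrN ger0_norm // ltW.
rewrite (great_arc_end hL) in h1.
have h2 : d (f (great_arc x z (sdist x z - e0))) (f z) = e0 by rewrite chart_isom.
have h3 : d (f (great_arc x z (sdist x z - e0))) (g z) = e0 by rewrite ea chart_isom.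
have := dist_triangle (f z) (f (great_arc x z (sdist x z - e0))) (g z).
by rewrite h3 (dist_sym (f z) (f _)) h2; lra.
Qed.
End Building.

(** * Consequences of the CAT(1) inequality *)

Section Triangle.
Variable R : realType.

Definition vec3 (x y z : R) : 'rV[R]_3 := \row_i nth 0 [:: x; y; z] i.

Lemma dotv_vec3 x y z x' y' z' :
  dotv (vec3 x y z) (vec3 x' y' z') = x * x' + y * y' + z * z'.
Proof. by rewrite /dotv !big_ord_recl big_ord0 !mxE /= addr0 addrA. Qed.

Lemma spherical_segment (a : R) : 0 <= a <= pi -> exists p q : 'rV[R]_3,
  [/\ usphere 3 p, usphere 3 q & sdist p q = a].
Proof.
move=> ha; exists (vec3 1 0 0), (vec3 (cos a) (sin a) 0).
rewrite /usphere /=; split; rewrite ?dotv_vec3; first by ring.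
  by have := cos2Dsin2 a; rewrite !expr2 mulr0 addr0.
by apply: sdist_eq => //; rewrite dotv_vec3; ring.
Qed.

(** With the first two vertices on the equator, the law of cosines gives the coordinates [cos b] and
    [k] of the third; the triangle inequalities and the perimeter bound make the radicand of its
    last coordinate nonnegative. *)
Lemma spherical_triangle (a b c : R) : 0 < a < pi -> 0 <= b <= pi -> 0 <= c <= pi ->
  c <= a + b -> b <= a + c -> a <= b + c -> a + b + c <= 2 * pi ->
  exists p q r : 'rV[R]_3, [/\ usphere 3 p, usphere 3 q & usphere 3 r] /\
    [/\ sdist p q = a, sdist q r = c & sdist r p = b].
Proof.
move=> ha hb hc h1 h2 h3 h4.
have sa : 0 < sin a by exact: sin_gt0_pi.
have {}ha : 0 <= a <= pi by case/andP: ha => *; apply/andP; split; lra.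
have sb : 0 <= sin b by exact: sin_ge0_pi.
have le1 : cos c <= cos a * cos b + sin a * sin b.
  rewrite -cosB -(cos_norm (a - b)).
  by apply: cos_le => //; rewrite ?normr_ge0 ?ler_norml; move: ha hb hc => /andP[? ?] /andP[? ?] /andP[? ?]; apply/andP; split; lra.
have le2 : cos a * cos b - sin a * sin b <= cos c.
  rewrite -cosD; move: ha hb hc => /andP[? ?] /andP[? ?] /andP[? ?].
  have [hab|hab] := leP (a + b) pi.
    by apply: cos_le => //; apply/andP; split; lra.
  (* Beyond [pi] the cosine is no longer decreasing; the perimeter bound reads
     [c <= 2 * pi - (a + b)]. *)
  have -> : cos (a + b) = cos (2 * pi - (a + b)).
    by rewrite -(cosN (2 * pi - _)) opprB mulr_natl cosB cos2pi sin2pi; ring.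
  by apply: cos_le; [apply/andP; split..|]; lra.
pose k := (cos c - cos a * cos b) / sin a.
have hk : k * sin a = cos c - cos a * cos b by rewrite /k divfK// gt_eqF.
have k2 : k ^+ 2 <= sin b ^+ 2.
  rewrite -[k ^+ 2]real_normK ?num_real// ler_sqr ?nnegrE//.
  rewrite ler_norml /k ler_pdivrMr// ler_pdivlMr// ; apply/andP; split; lra.
exists (vec3 1 0 0), (vec3 (cos a) (sin a) 0), (vec3 (cos b) k (Num.sqrt (sin b ^+ 2 - k ^+ 2))).
have ss : Num.sqrt (sin b ^+ 2 - k ^+ 2) * Num.sqrt (sin b ^+ 2 - k ^+ 2) = sin b ^+ 2 - k ^+ 2.
  by rewrite -expr2 sqr_sqrtr// subr_ge0.
split; rewrite /usphere /=; split; rewrite ?dotv_vec3.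
- by ring.
- by have := cos2Dsin2 a; rewrite !expr2 mulr0 addr0.
- by rewrite ss; have := cos2Dsin2 b; lra.
- by apply: sdist_eq => //; rewrite dotv_vec3; ring.
- by apply: sdist_eq => //; rewrite dotv_vec3 mul0r (mulrC (sin a)) hk; ring.
- by apply: sdist_eq => //; rewrite dotv_vec3; ring.
Qed.

Lemma arc_pointE (a b : 'rV[R]_3) t : sdist a b != 0 -> arc_point a b t = great_arc a b t.
Proof. by rewrite /arc_point => /negbTE ->. Qed.

Lemma usphere_arc_point (a b : 'rV[R]_3) t : usphere 3 a -> usphere 3 b -> sdist a b < pi ->
  usphere 3 (arc_point a b t).
Proof.
move=> ha hb hab; case/andP: (sdist_bounds ha hb) => h0 _.
have [e|ne] := eqVneq (sdist a b) 0; first by rewrite /arc_point e eqxx.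
by rewrite arc_pointE//; apply: usphere_great_arc => //; rewrite lt_def ne h0.
Qed.

Lemma arc_point_end (a b : 'rV[R]_3) : usphere 3 a -> usphere 3 b -> sdist a b < pi ->
  arc_point a b (sdist a b) = b.
Proof.
move=> ha hb hab; case/andP: (sdist_bounds ha hb) => h0 _.
have [e|ne] := eqVneq (sdist a b) 0.
  by rewrite /arc_point e eqxx; apply: unit_dotv1; rewrite -?cos_sdist// e cos0.
by rewrite arc_pointE// great_arc_end// lt_def ne h0.
Qed.
End Triangle.

Section Geodesics.
Variables (R : realType) (n : nat) (B : Type) (d : B -> B -> R).
Variable A : set ('rV[R]_(n.+1) -> B).
Hypothesis bld : building_An n d A.
Local Notation V := 'rV[R]_(n.+1).

(** Comparison for the degenerate triangle [p], [q], [q]: the two geodesics are its sides at [p] and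
    have the same model arc. *)
Lemma geodesic_unique p q g1 g2 t : d p q < pi -> geodesic d p q g1 -> geodesic d p q g2 ->
  0 <= t <= d p q -> g1 t = g2 t.
Proof.
move=> hpq hg1 hg2 ht; apply: (dist_eq0 bld); apply/eqP.
rewrite eq_le; case/andP: (dist_bounds bld (g1 t) (g2 t)) => -> _; rewrite andbT.
case: (spherical_segment (dist_bounds bld p q)) => a [b [ha hb hab]].
have hab' : sdist b a = d q p by rewrite (dist_sym bld q) -hab /sdist dotvC.
case: bld => -[_ [_ H]] _ _ _ _.
have := H p q q g1 g2 a b b _ hg1 hg2 ha hb hb hab _ hab' t t ht ht.
rewrite (distxx bld) addr0 (dist_sym bld q) sdistxx//.
move=> /(_ _ erefl) /le_trans -> //; first by lra.
by rewrite sdistxx//; apply: usphere_arc_point; rewrite ?hab.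
Qed.

Lemma chart_geodesic f x y : A f -> SA n x -> SA n y -> 0 < sdist x y < pi ->
  geodesic d (f x) (f y) (fun t => f (great_arc x y t)).
Proof.
move=> Af hx hy hxy; have hs t : SA n (great_arc x y t) by exact: SA_great_arc.
split; rewrite ?(chart_isom bld)// ?great_arc0 ?great_arc_end// => s t hs' ht.
by rewrite (chart_isom bld)//; apply: sdist_great_arc => //; [case: hx|case: hy].
Qed.

(** On the round sphere this is an equality, an arc being a linear combination of its end points;
    comparison can only shorten the distance to [r], that is, raise its cosine. *)
Lemma CAT1_concave p q r g s : 0 < d p q -> d p r < pi ->
  d p q + d q r + d r p < 2 * pi -> geodesic d p q g -> 0 <= s <= d p q ->
  sin (d p q - s) * cos (d p r) + sin s * cos (d q r) <= sin (d p q) * cos (d (g s) r).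
Proof.
move=> pq0 pr1 hper hg hs; have hpq := dist_bounds bld p q.
have pq1 : d p q < pi.
  by have := dist_triangle bld p r q; rewrite (dist_sym bld p r) (dist_sym bld r q); lra.
case: (@spherical_triangle R (d p q) (d r p) (d q r)); rewrite ?pq0 ?(dist_bounds bld)//.
- by rewrite addrC (dist_sym bld r p) (dist_sym bld p q) addrC; apply: (dist_triangle bld).
- by rewrite (dist_sym bld r p); apply: (dist_triangle bld).
- by rewrite (dist_sym bld r p) (dist_sym bld q r); apply: (dist_triangle bld).
- by move: hper; lra.
move=> a [b [c [[ha hb hc] [hab hbc hca]]]].
case: bld => -[_ [geo H]] _ _ _ _.
have [g2 hg2] := geo _ _ pr1.
have hr : 0 <= d p r <= d p r by rewrite lexx andbT; case/andP: (dist_bounds bld p r).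
have := H p q r g g2 a b c hper hg hg2 ha hb hc hab hbc hca s (d p r) hs hr.
have -> : g2 (d p r) = r by case: hg2.
have hac : sdist a c = d p r by rewrite (dist_sym bld p r) -hca /sdist dotvC.
rewrite -{1}hac arc_point_end ?hac// => hle.
have ua : usphere 3 (arc_point a b s) by apply: usphere_arc_point; rewrite ?hab.
have := cos_le (dist_bounds bld (g s) r) (sdist_bounds ua hc) hle.
rewrite cos_sdist// arc_pointE; last by rewrite hab gt_eqF.
rewrite /great_arc hab !(dotvDl, dotvZl) -!cos_sdist// hac hbc.
have sp : 0 < sin (d p q) by apply: sin_gt0_pi; rewrite pq0.
by rewrite ler_pdivrMl.
Qed.
End Geodesics.

(** * The cone over the building *)

Section Polar.
Variables (R : realType) (n : nat) (B : Type).
Local Notation V := 'rV[R]_(n.+1).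
Implicit Types (f g h : V -> B) (u v w x y z : V) (s : 'S_(n.+1)).

Definition mean v : R := (\sum_i v ord0 i) / n.+1%:R.
Definition cen v : V := v - const_mx (mean v).
Definition nrm v : R := Num.sqrt (dotv (cen v) (cen v)).

(* The point of R x (Euclidean cone over B) that the chart [f] assigns to [v]: the R factor
   is the coordinate along (1, ..., 1). *)
Definition cone f v : R * R * option B :=
  (mean v, nrm v, if nrm v == 0 then None else Some (f ((nrm v)^-1 *: cen v))).

Lemma meanD v w : mean (v + w) = mean v + mean w.
Proof. by rewrite /mean -mulrDl -big_split /=; congr (_ / _); apply: eq_bigr => i _; rewrite mxE. Qed.

Lemma meanZ a v : mean (a *: v) = a * mean v.
Proof. by rewrite /mean mulrA mulr_sumr; congr (_ / _); apply: eq_bigr => i _; rewrite mxE. Qed.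

Lemma mean_const c : mean (const_mx c) = c.
Proof.
rewrite /mean; under eq_bigr do rewrite mxE.
by rewrite sumr_const card_ord -[c *+ _]mulr_natr mulfK// pnatr_eq0.
Qed.

Lemma mean_SA u : SA n u -> mean u = 0.
Proof. by case=> _ h; rewrite /mean h mul0r. Qed.

Lemma cenD v w : cen (v + w) = cen v + cen w.
Proof. by rewrite /cen meanD; apply/rowP => i; rewrite !mxE; ring. Qed.

Lemma cenZ a v : cen (a *: v) = a *: cen v.
Proof. by rewrite /cen meanZ; apply/rowP => i; rewrite !mxE; ring. Qed.

Lemma cen_const c : cen (const_mx c) = 0.
Proof. by rewrite /cen mean_const subrr. Qed.

Lemma cen_SA u : SA n u -> cen u = u.
Proof. by move=> h; rewrite /cen mean_SA//; apply/rowP => i; rewrite !mxE subr0. Qed.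

Lemma cen_sum v : \sum_i cen v ord0 i = 0.
Proof.
rewrite /cen; under eq_bigr do rewrite !mxE.
by rewrite big_split /= sumrN sumr_const card_ord -[mean v *+ _]mulr_natr divfK ?subrr// pnatr_eq0.
Qed.

Lemma cone_const f c : cone f (const_mx c) = (c, 0, None).
Proof.
have e : nrm (const_mx c) = 0.
  by rewrite /nrm cen_const /dotv big1 ?sqrtr0// => i _; rewrite mxE mul0r.
by rewrite /cone mean_const e eqxx.
Qed.

Lemma cone_polar f c r u : SA n u -> 0 < r -> cone f (const_mx c + r *: u) = (c, r, Some (f u)).
Proof.
move=> hu r0; have [u1 _] := hu.
have ec : cen (const_mx c + r *: u) = r *: u by rewrite cenD cenZ cen_const cen_SA// add0r.
have en : nrm (const_mx c + r *: u) = r.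
  by rewrite /nrm ec dotvZl dotvZr u1 mulr1 -expr2 sqrtr_sqr gtr0_norm.
rewrite /cone en ec meanD meanZ mean_const mean_SA// mulr0 addr0 gt_eqF//.
by rewrite scalerA mulVf ?scale1r ?gt_eqF.
Qed.

Lemma normalize v : v != 0 -> \sum_i v ord0 i = 0 ->
  exists r u, [/\ 0 < r, SA n u & v = r *: u].
Proof.
move=> v0 vs; have r0 : 0 < Num.sqrt (dotv v v).
  by rewrite sqrtr_gt0 lt_def dotv_ge0 andbT; apply: contra v0 => /eqP/dotv_eq0 ->.
exists (Num.sqrt (dotv v v)), ((Num.sqrt (dotv v v))^-1 *: v); split=> //.
  split; last by under eq_bigr do rewrite mxE; rewrite -mulr_sumr vs mulr0.
  rewrite /usphere /= dotvZl dotvZr mulrA -[X in _ * X](sqr_sqrtr (dotv_ge0 v)).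
  by rewrite -expr2 -exprMn mulVf ?expr1n// gt_eqF.
by rewrite scalerA divff ?scale1r// gt_eqF.
Qed.

Lemma polar v : (exists c, v = const_mx c) \/
  exists c r u, [/\ 0 < r, SA n u & v = const_mx c + r *: u].
Proof.
have [e|ne] := eqVneq (cen v) 0; [left|right]; exists (mean v).
  by rewrite -[v in LHS](subrK (const_mx (mean v))) -/(cen v) e add0r.
case: (normalize ne (cen_sum v)) => r [u [r0 hu e]]; exists r, u; split=> //.
by rewrite -e addrC subrK.
Qed.

Lemma coarse_const (c : R) w : coarse (const_mx c : V) w -> exists c', w = const_mx c'.
Proof.
move=> h; exists (w ord0 ord0); apply/rowP => i; rewrite mxE; apply/eqP.
by rewrite eq_le !h// !mxE.
Qed.

Lemma coarse_polar c r u c' r' u' : 0 < r -> 0 < r' ->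
  coarse (const_mx c + r *: u) (const_mx c' + r' *: u') -> coarse u u'.
Proof.
move=> r0 r0' h i j hij; have := h i j; rewrite !mxE !lerD2l !ler_pM2l//; exact.
Qed.
End Polar.

Section Cone.
Variables (R : realType) (n : nat) (B : Type) (d : B -> B -> R).
Variable A : set ('rV[R]_(n.+1) -> B).
Hypothesis bld : building_An n d A.
Local Notation V := 'rV[R]_(n.+1).
Implicit Types (f g h : V -> B) (u v w x y z : V) (s : 'S_(n.+1)).

Lemma cone_Wact f s v : cone (f \o Wact s) v = cone f (Wact s v).
Proof.
case: (polar v) => [[c ->]|[c [r [u [r0 hu ->]]]]]; first by rewrite Wact_const !cone_const.
by rewrite WactD WactZ Wact_const !cone_polar//; apply: Wact_SA.
Qed.

Lemma cone_change f g : A f -> A g -> exists s, forall v w, cone f v = cone g w -> w = Wact s v.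
Proof.
move=> Af Ag; case: (chart_change bld Af Ag) => s hs; exists s => v w.
case: (polar v) => [[c ->]|[c [r [u [r0 hu ->]]]]];
  case: (polar w) => [[c' ->]|[c' [r' [u' [r0' hu' ->]]]]]; rewrite ?cone_const ?cone_polar//.
  by case=> ->; rewrite Wact_const.
by case=> -> -> /hs ->//; rewrite WactD WactZ Wact_const.
Qed.

Lemma cone_inj f v w : A f -> cone f v = cone f w -> v = w.
Proof. by move=> Af e; case: (cone_change Af Af) => s hs; rewrite (hs v v)// (hs v w). Qed.

Lemma cone_face f g v w : A f -> A g -> coarse v w -> cone f v = cone g v -> cone f w = cone g w.
Proof.
move=> Af Ag; case: (polar v) => [[c ->]|[c [r [u [r0 hu ->]]]]].
  by move=> /coarse_const [c' ->]; rewrite !cone_const.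
case: (polar w) => [[c' ->]|[c' [r' [u' [r0' hu' ->]]]]]; rewrite ?cone_const ?cone_polar//.
move=> /(coarse_polar r0 r0') cu [e]; congr (_, Some _).
exact: (chart_face bld) e cu.
Qed.

(** Precomposing with an element of [W] lets the common chart keep the coordinates [v] of the first
    point; only those of the second get permuted. *)
Lemma cone_common f g v w : A f -> A g ->
  exists2 h, A h & cone h v = cone f v /\ exists s, cone h (Wact s w) = cone g w.
Proof.
move=> Af Ag.
case: (polar v) => [[c ->]|[c [r [u [r0 hu ev]]]]].
  by exists g => //; rewrite !cone_const; split=> //; exists 1%g; rewrite Wact1.
case: (polar w) => [[c' ->]|[c' [r' [u' [r0' hu' ew]]]]].
  by exists f => //; split=> //; exists 1%g; rewrite Wact1 !cone_const.
case: (common_chart bld (f u) (g u')) => h Ah [x [y [hx hy ex ey]]].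
case: (chart_change bld Af Ah) => s0 /(_ _ _ hu hx (esym ex)) e0.
case: (chart_change bld Ag Ah) => s1 /(_ _ _ hu' hy (esym ey)) e1.
exists (h \o Wact s0); first exact: (chart_Wact bld).
rewrite ev ew; split; first by rewrite !cone_polar//= -e0 ex.
exists (s0^-1 * s1)%g; rewrite cone_Wact WactM mulgA mulgV mul1g.
by rewrite WactD WactZ Wact_const -e1 !cone_polar// ey.
Qed.

(* The inner product on the product of the cone over B with the line. *)
Definition ip (p q : R * R * option B) : R :=
  n.+1%:R * p.1.1 * q.1.1 +
  (if p.2 is Some b then if q.2 is Some b' then p.1.2 * q.1.2 * cos (d b b') else 0 else 0).

Lemma ip_cone f v w : A f -> ip (cone f v) (cone f w) = dotv v w.
Proof.
move=> Af.
have d0 c c' : dotv (const_mx c : V) (const_mx c') = n.+1%:R * c * c'.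
  rewrite /dotv; under eq_bigr do rewrite !mxE.
  by rewrite sumr_const card_ord -[_ *+ _]mulr_natl mulrA.
have d1 c u : SA n u -> dotv (const_mx c : V) u = 0.
  case=> _ h; rewrite /dotv; under eq_bigr do rewrite !mxE.
  by rewrite -mulr_sumr h mulr0.
case: (polar v) => [[c ->]|[c [r [u [r0 hu ->]]]]];
  case: (polar w) => [[c' ->]|[c' [r' [u' [r0' hu' ->]]]]];
  rewrite ?cone_const ?cone_polar// /ip /= ?(dotvDl, dotvDr, dotvZl, dotvZr) ?d0 ?d1//
    ?(dotvC _ (const_mx _)) ?d1// ?mulr0 ?addr0 ?add0r//.
by rewrite (chart_isom bld)// cos_sdist ?mulrA//; [case: hu|case: hu'].
Qed.

(** Homogeneous form of [CAT1_concave]. Both points are closer than [pi / 2] to [t], so they are not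
    antipodal and the triangle has perimeter less than [2 * pi]. *)
Lemma sphere_concave f x y r r' (t : B) : A f -> SA n x -> SA n y -> 0 < r -> 0 < r' ->
  0 < cos (d (f x) t) -> 0 < cos (d (f y) t) ->
  exists rho z, [/\ 0 < rho, SA n z, r *: x + r' *: y = rho *: z &
    r * cos (d (f x) t) + r' * cos (d (f y) t) <= rho * cos (d (f z) t)].
Proof.
move=> Af hx hy r0 r0' cx cy.
have lt_half p : 0 < cos (d p t) -> d p t < pi / 2.
  move=> c0; apply: cos_lt; [|exact: (dist_bounds bld)|by rewrite cos_pihalf].
  by have := @pi_ge0 R => ?; apply/andP; split; lra.
have dx := lt_half _ cx; have dy := lt_half _ cy.
have [e|/eqP nxy] := eqVneq x y.
  exists (r + r'), x; split; rewrite ?addr_gt0// -e; first by rewrite scalerDl.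
  by rewrite mulrDl.
have dxy : d (f x) (f y) < pi.
  by have := dist_triangle bld (f x) t (f y); rewrite (dist_sym bld t); lra.
have hL : 0 < sdist x y < pi.
  by rewrite sdist_gt0//= -(chart_isom bld Af).
have t0 : r *: x + r' *: y != 0.
  apply/eqP => e; move: dxy; rewrite (chart_isom bld)//.
  have [hx1 _] := hx; have [hy1 _] := hy.
  have e1 : dotv (r *: x + r' *: y) x = 0 by rewrite e /dotv big1// => i _; rewrite mxE mul0r.
  have e2 : dotv (r *: x + r' *: y) y = 0 by rewrite e /dotv big1// => i _; rewrite mxE mul0r.
  rewrite !(dotvDl, dotvZl) hx1 hy1 (dotvC y x) !mulr1 in e1 e2.
  have dd : dotv x y = -1.
    have rr : (r - r') * (r + r') = 0.
      have : r * (r + r' * dotv x y) - r' * (r * dotv x y + r') = 0 by rewrite e1 e2; ring.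
      by move=> <-; ring.
    move/eqP: rr; rewrite mulf_eq0 (gt_eqF (addr_gt0 r0 r0')) orbF subr_eq0 => /eqP rr.
    move: e2; rewrite -rr -[X in _ + X]mulr1 -mulrDr => /eqP; rewrite mulf_eq0 gt_eqF//=.
    by rewrite addr_eq0 => /eqP.
  by rewrite /sdist dd acosN1 ltxx.
have ts : \sum_i (r *: x + r' *: y) ord0 i = 0.
  under eq_bigr do rewrite !mxE.
  by rewrite big_split /= -!mulr_sumr hx.2 hy.2 !mulr0 addr0.
case: (normalize t0 ts) => rho [z [rho0 hz ez]]; exists rho, z; split=> //.
have [hx1 _] := hx; have [hy1 _] := hy; have [hz1 _] := hz.
case: (@great_arcP _ _ x y z (r / rho) (r' / rho)) => //; rewrite ?divr_ge0 ?(ltW r0) ?(ltW r0') ?(ltW rho0)//.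
  by rewrite !(mulrC _ rho^-1) -!scalerA -scalerDr ez scalerA mulVf ?scale1r ?gt_eqF.
move=> s hs [es [e1 e2]].
have hg := chart_geodesic bld Af hx hy hL.
have := CAT1_concave (r := t) bld _ _ _ hg.
rewrite (chart_isom bld)// => /(_ s); case/andP: (hL) => L0 L1.
have pp := @pi_gt0 R.
move=> /(_ L0 _ _ hs); rewrite -es e1 e2 => H.
have {}H : r / rho * sin (sdist x y) * cos (d (f x) t) + r' / rho * sin (sdist x y) * cos (d (f y) t) <=
    sin (sdist x y) * cos (d (f z) t).
  apply: H; first by lra.
  have := dist_triangle bld (f x) t (f y); rewrite (chart_isom bld)//.
  by rewrite (dist_sym bld t (f y)) (dist_sym bld t (f x)); lra.
have sp : 0 < sin (sdist x y) by exact: sin_gt0_pi.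
rewrite -(ler_pM2l sp) -(ler_pM2l (x := rho^-1)) ?invr_gt0//.
apply: le_trans (_ : _ <= sin (sdist x y) * cos (d (f z) t)) _; last first.
  by rewrite [leRHS](_ : _ = sin (sdist x y) * cos (d (f z) t))//; field; rewrite gt_eqF.
by apply: le_trans H; rewrite le_eqVlt; apply/orP; left; apply/eqP; ring.
Qed.

(** [n.+1%:R * mean k * mean v] is the contribution of the line factor to the inner product, so the
    hypotheses say that the cone components meet at angles below [pi / 2], where the triangle is
    small enough for comparison. *)
Lemma cone_concave f g k v w : A f -> A g ->
  n.+1%:R * mean k * mean v < ip (cone g k) (cone f v) ->
  n.+1%:R * mean k * mean w < ip (cone g k) (cone f w) ->
  ip (cone g k) (cone f v) + ip (cone g k) (cone f w) <= ip (cone g k) (cone f (v + w)).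
Proof.
move=> Af Ag.
have key p (c : R) q : p = cone g k -> q.1.1 = c ->
    n.+1%:R * mean k * c < ip p q ->
    exists2 t, p = (mean k, nrm k, Some t) & 0 < nrm k.
  rewrite /cone => -> e; case: ifPn => [_|n0 _].
    by rewrite /ip /= e addr0 ltxx.
  by exists (g ((nrm k)^-1 *: cen k)) => //; rewrite lt_def n0 sqrtr_ge0.
move=> h1 h2; case: (key _ _ _ erefl _ h1) => // t et k0; move: h1 h2; rewrite et.
case: (polar v) => [[c ->]|[c [r [u [r0 hu ->]]]]].
  by rewrite cone_const /ip /= mean_const addr0 ltxx.
case: (polar w) => [[c' ->]|[c' [r' [u' [r0' hu' ->]]]]].
  by rewrite cone_const /ip /= mean_const addr0 ltxx.
have pos a b x : SA n x -> 0 < b ->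
    n.+1%:R * mean k * mean (const_mx a + b *: x) < ip (mean k, nrm k, Some t) (a, b, Some (f x)) ->
    0 < cos (d (f x) t).
  move=> hx b0; rewrite /ip /= meanD meanZ mean_const (mean_SA hx) mulr0 addr0.
  by rewrite ltrDl (dist_sym bld t) !pmulr_rgt0 ?mulr_gt0.
rewrite !cone_polar// => /(pos _ _ _ hu r0) h1 /(pos _ _ _ hu' r0') h2.
case: (sphere_concave Af hu hu' r0 r0' h1 h2) => rho [z [rho0 hz ez hle]].
have -> : const_mx c + r *: u + (const_mx c' + r' *: u') = const_mx (c + c') + rho *: z.
  by rewrite -ez; apply/rowP => i; rewrite !mxE; ring.
rewrite cone_polar// /ip /= !(dist_sym bld t).
rewrite -(ler_pM2l k0) in hle.
by rewrite (mulrDr _ c c') -!addrA lerD2l addrCA lerD2l -!mulrA -mulrDr.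
Qed.

(** * Filtrations lying over a convex subcomplex *)

Section Subcomplex.
Variable C : set B.
Hypothesis cvxC : convex_subcomplex d A C.

Definition inC (p : R * R * option B) : Prop := if p.2 is Some b then C b else True.

Lemma wallAP (i j : 'I_n.+1) x : SA n x -> wallA i j x <-> x ord0 i = x ord0 j.
Proof.
move=> hx; split=> [[_ h]|h].
  by move/rowP: h => /(_ j); rewrite WactE tpermR.
split=> //; apply/rowP => k; rewrite WactE.
by case: tpermP => [->|->|].
Qed.

(** The face of [C] through [f x] comes with its own chart; after a permutation that chart has the
    coordinates of [f] at [x], hence agrees with [f] on the closed face of [x]. *)
Lemma subcomplex_face f x z : A f -> SA n x -> SA n z -> coarse x z -> C (f x) -> C (f z).
Proof.
move=> Af hx hz cxz; case: cvxC => _ H /H [F [[g [F0 [Ag [[w [P [hP ->]]] ->]]]]]] [[x' [hx' hP'] ex'] sub].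
have hxx : SA n x' by case: hx'.
case: (chart_change bld Af Ag) => s /(_ x x' hx hxx (esym ex')) es.
apply: sub; exists (Wact s z).
  have cc : coarse x' (Wact s z) by rewrite es; apply: Wact_coarse.
  have hsz : SA n (Wact s z) by exact: Wact_SA.
  split; first by split=> // i j ij; apply: cc; case: hx' => _; apply.
  move=> ij /hP'; rewrite !wallAP// => e; exact: coarse_eq e.
have Ags : A (g \o Wact s) by exact: (chart_Wact bld).
have ee : f x = (g \o Wact s) x by rewrite /= -es.
by rewrite (chart_face bld Af Ags hx hz ee cxz).
Qed.

(** Convexity is silent about antipodal points, but a unit vector combining [x] with [- x] is one of
    the two. *)
Lemma subcomplex_sum f x y z a b : A f -> SA n x -> SA n y -> SA n z -> 0 <= a -> 0 <= b ->
  z = a *: x + b *: y -> C (f x) -> C (f y) -> C (f z).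
Proof.
move=> Af hx hy hz a0 b0 ez Cx Cy; have [hx1 _] := hx; have [hy1 _] := hy; have [hz1 _] := hz.
have scal t : z = t *: x -> z = x \/ z = - x.
  move=> e; have : dotv z z = 1 by [].
  rewrite {1 2}e dotvZl dotvZr hx1 mulr1 -expr2 => /eqP; rewrite sqrf_eq1.
  by move=> /orP[] /eqP et; [left|right]; rewrite e et ?scale1r ?scaleN1r.
have [exy|/eqP nxy] := eqVneq x y.
  have e : z = (a + b) *: x by rewrite ez -exy scalerDl.
  case: (scal _ e) => [->//|e']; have e1 : dotv z x = a + b by rewrite e dotvZl hx1 mulr1.
  have : dotv z x = -1 by rewrite e' -scaleN1r dotvZl hx1 mulr1.
  by rewrite e1 => h; exfalso; lra.
have [exy|/eqP nxy'] := eqVneq y (- x).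
  have e : z = (a - b) *: x by rewrite ez exy scalerN scalerBl.
  by case: (scal _ e) => ->//; rewrite -exy.
have hL : 0 < sdist x y < pi by rewrite sdist_gt0 ?sdist_lt_pi.
case: (great_arcP hx1 hy1 hL a0 b0 ez hz1) => t ht [-> _].
case: cvxC => cv _; have hg := chart_geodesic bld Af hx hy hL.
have dxy : d (f x) (f y) < pi by rewrite (chart_isom bld)//; case/andP: hL.
apply: (cv _ _ _ Cx Cy dxy hg); exists t => //.
by rewrite (chart_isom bld).
Qed.

Lemma inC_face f v w : A f -> coarse v w -> inC (cone f v) -> inC (cone f w).
Proof.
move=> Af; case: (polar v) => [[c ->]|[c [r [u [r0 hu ->]]]]].
  by move=> /coarse_const [c' ->]; rewrite !cone_const.
case: (polar w) => [[c' ->]|[c' [r' [u' [r0' hu' ->]]]]]; rewrite ?cone_const ?cone_polar//.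
move=> /(coarse_polar r0 r0') cu; exact: subcomplex_face.
Qed.

Lemma inC_add f v w : A f -> inC (cone f v) -> inC (cone f w) -> inC (cone f (v + w)).
Proof.
move=> Af; case: (polar v) => [[c ->]|[c [r [u [r0 hu ->]]]]].
  move=> _; apply: inC_face => // i j; rewrite !mxE; lra.
case: (polar w) => [[c' ->]|[c' [r' [u' [r0' hu' ->]]]]].
  move=> h _; move: h; apply: inC_face => // i j; rewrite !mxE; lra.
move=> h1 h2.
have {}h1 : C (f u) by move: h1; rewrite cone_polar.
have {}h2 : C (f u') by move: h2; rewrite cone_polar.
have -> : const_mx c + r *: u + (const_mx c' + r' *: u') = const_mx (c + c') + (r *: u + r' *: u').
  by apply/rowP => i; rewrite !mxE; ring.
have [e|ne] := eqVneq (r *: u + r' *: u') 0; first by rewrite e addr0 cone_const.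
have ts : \sum_i (r *: u + r' *: u') ord0 i = 0.
  under eq_bigr do rewrite !mxE.
  by rewrite big_split /= -!mulr_sumr hu.2 hu'.2 !mulr0 addr0.
case: (normalize ne ts) => rho [z [rho0 hz ez]]; rewrite ez cone_polar//=.
apply: (@subcomplex_sum f u u' z (r / rho) (r' / rho)) => //; rewrite ?divr_ge0 ?(ltW r0) ?(ltW r0') ?(ltW rho0)//.
by rewrite !(mulrC _ rho^-1) -!scalerA -scalerDr ez scalerA mulVf ?scale1r ?gt_eqF.
Qed.

Lemma inC_scale f v a : A f -> 0 <= a -> inC (cone f v) -> inC (cone f (a *: v)).
Proof.
by move=> Af a0; apply: inC_face => // i j h; rewrite !mxE ler_wpM2l.
Qed.
End Subcomplex.
End Cone.

(** * The modular lattice of vertices *)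

Section Indicator.
Variables (R : realType) (n : nat).
Local Notation V := 'rV[R]_(n.+1).
Implicit Types (I J K : {set 'I_n.+1}) (v : V).

(** The filtration with a single jump, at the coordinate subspace of [I]; for proper nonempty [I]
    its centred direction is a vertex of the model complex. *)
Definition ind I : V := \row_i (i \in I)%:R.

Lemma indE I i : ind I ord0 i = (i \in I)%:R.
Proof. by rewrite mxE. Qed.

Lemma dotv_ind I J : dotv (ind I) (ind J) = #|I :&: J|%:R.
Proof.
rewrite /dotv -sum1_card natr_sum [RHS]big_mkcond /=; apply: eq_bigr => i _.
by rewrite !indE inE; case: (i \in I); case: (i \in J); rewrite /= ?mulr1 ?mulr0.
Qed.

Lemma mean_ind I : mean (ind I) = #|I|%:R / n.+1%:R.
Proof.
rewrite /mean -sum1_card natr_sum [in RHS]big_mkcond /=; congr (_ / _).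
by apply: eq_bigr => i _; rewrite indE; case: (i \in I).
Qed.

Lemma Wact_ind (s : 'S_n.+1) I : Wact s (ind I) = ind (s @^-1: I).
Proof. by apply/rowP => i; rewrite WactE !indE inE. Qed.

Lemma ind_inj : injective ind.
Proof.
move=> I J /rowP e; apply/setP => i; have := e i; rewrite !indE => /eqP.
by rewrite eqr_nat; case: (i \in I); case: (i \in J).
Qed.

Lemma coarse_ind v I : (forall i j, v ord0 i <= v ord0 j -> i \in I -> j \in I) -> coarse v (ind I).
Proof.
move=> h i j hij; rewrite !indE; have := h i j hij.
by case: (i \in I); case: (j \in I) => // /(_ isT).
Qed.

Lemma indDE I J i : (ind I + ind J) ord0 i = (i \in I)%:R + (i \in J)%:R.
Proof. by rewrite mxE !indE. Qed.

(** [I :&: J] and [I :|: J] are the superlevel sets of [ind I + ind J] at 2 and 1, so a single point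
    of the cone carries meet and join in its closed face. *)
Lemma coarse_indI I J : coarse (ind I + ind J) (ind (I :&: J)).
Proof.
apply: coarse_ind => i j; rewrite !indDE !inE => h /andP[iI iJ]; move: h; rewrite iI iJ.
by case: (j \in I); case: (j \in J) => //=; lra.
Qed.

Lemma coarse_indU I J : coarse (ind I + ind J) (ind (I :|: J)).
Proof.
apply: coarse_ind => i j; rewrite !indDE !inE.
by case: (j \in I); case: (j \in J) => //=; case: (i \in I); case: (i \in J) => //=; lra.
Qed.

Definition up v (l : R) : {set 'I_n.+1} := finset (fun i => l <= v ord0 i).
Definition upo v (l : R) : {set 'I_n.+1} := finset (fun i => l < v ord0 i).

Lemma coarse_up v w l : coarse v w -> coarse v (ind (up w l)).
Proof. by move=> h; apply: coarse_ind => i j /h hij; rewrite !inE => /le_trans; apply. Qed.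

Lemma coarse_upo v w l : coarse v w -> coarse v (ind (upo w l)).
Proof. by move=> h; apply: coarse_ind => i j /h hij; rewrite !inE => /lt_le_trans; apply. Qed.
End Indicator.
Arguments ind R {n} I.

Definition select (T : Type) (x0 : T) (P : T -> Prop) : T :=
  if pselect (exists x, P x) is left e then projT1 (cid e) else x0.

Lemma selectP (T : Type) (x0 : T) (P : T -> Prop) x : P x -> P (select x0 P).
Proof.
by rewrite /select => Px; case: pselect => [e|[]]; [exact: projT2 (cid e)|exists x].
Qed.

Section Lattice.
Variables (R : realType) (n : nat) (B : Type) (d : B -> B -> R).
Variable A : set ('rV[R]_(n.+1) -> B).
Hypothesis bld : building_An n d A.
Local Notation V := 'rV[R]_(n.+1).
Local Notation ind := (ind R).
Implicit Types (f g h : V -> B) (u v w x y z : V) (s : 'S_(n.+1)).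
Implicit Types (I J K : {set 'I_n.+1}) (p q r : R * R * option B).

Definition cle p q := exists2 f, A f & exists I J, [/\ I \subset J, p = cone f (ind I) & q = cone f (ind J)].

Lemma cone_ind_common f g v I : A f -> A g ->
  exists2 h, A h & cone h v = cone f v /\ exists J, cone h (ind J) = cone g (ind I).
Proof.
move=> Af Ag; case: (cone_common bld v (ind I) Af Ag) => h Ah [e [s es]].
by exists h => //; split=> //; exists (s @^-1: I); rewrite -Wact_ind.
Qed.

Lemma cle_chart f I J : A f -> cle (cone f (ind I)) (cone f (ind J)) <-> I \subset J.
Proof.
move=> Af; split=> [[g Ag [I' [J' [sub e1 e2]]]]|sub]; last first.
  by exists f => //; exists I, J.
case: (cone_change bld Ag Af) => s hs.
have := hs _ _ (esym e1); have := hs _ _ (esym e2); rewrite !Wact_ind => /ind_inj -> /ind_inj ->.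
exact: preimsetS.
Qed.

(** In a chart the inner product counts the intersection, here the smaller subspace; no larger value
    is possible, which makes inclusion an extremal property of inner products. *)
Lemma ip_cle p q : cle p q -> ip n d p q = n.+1%:R * p.1.1 /\ ip n d q p = n.+1%:R * p.1.1.
Proof.
case=> f Af [I [J [sub -> ->]]]; rewrite !(ip_cone bld)// !dotv_ind setIC /= mean_ind.
by rewrite mulrCA divff ?mulr1 ?pnatr_eq0// (setIidPr sub).
Qed.

Lemma mean_ind_lt1 I : I != setT -> mean (ind I) < 1.
Proof.
move=> hI; rewrite mean_ind ltr_pdivrMr ?ltr0n// mul1r ltr_nat.
by rewrite -[X in (_ < X)%N]card_ord -cardsT proper_card// properEneq hI subsetT.
Qed.

Lemma mean_ind_gt0 I : I != set0 -> 0 < mean (ind I).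
Proof. by move=> hI; rewrite mean_ind divr_gt0 ?ltr0n// card_gt0. Qed.

Lemma cone_set0 f g : cone f (ind set0) = cone g (ind set0).
Proof.
have e0 : (ind set0 : V) = const_mx 0 by apply/rowP => i; rewrite !mxE inE.
by rewrite e0 !cone_const.
Qed.

Lemma cone_setT f g : cone f (ind setT) = cone g (ind setT).
Proof.
have e0 : (ind setT : V) = const_mx 1 by apply/rowP => i; rewrite !mxE inE.
by rewrite e0 !cone_const.
Qed.

Lemma card_sum_sub I J K : (#|K|%:R + #|K|%:R <= #|K :&: I|%:R + #|K :&: J|%:R :> R) ->
  K \subset I :&: J.
Proof.
rewrite -!natrD ler_nat => h; rewrite subsetI.
have hI := subset_leq_card (subsetIl K I); have hJ := subset_leq_card (subsetIl K J).
have eI : K :&: I = K by apply/eqP; rewrite eqEcard subsetIl /= -(leq_add2r #|K|) (leq_trans h)// leq_add2l.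
have eJ : K :&: J = K by apply/eqP; rewrite eqEcard subsetIl /= -(leq_add2l #|K|) (leq_trans h)// leq_add2r.
by rewrite -{1}eI -{2}eJ !subsetIr.
Qed.

(* The inner product with [t] is concave along the segment from [U] to [W], and
   [t <= U] means that it takes its extreme value at [U]. *)
Lemma cle_setI t f I J : A f -> cle t (cone f (ind I)) -> cle t (cone f (ind J)) ->
  cle t (cone f (ind (I :&: J))).
Proof.
move=> Af tI tJ; case: (tI) => g Ag [K [I' [_ et _]]].
(* For the zero and the whole space the cone component vanishes, and the strict inequalities
   required for concavity fail. *)
have [K0|K0] := eqVneq K set0.
  by rewrite et K0 (cone_set0 g f); apply/cle_chart => //; apply: sub0set.
have [I1|I1] := eqVneq I setT; first by rewrite I1 setTI.
have [J1|J1] := eqVneq J setT; first by rewrite J1 setIT.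
(* Three subspaces are not known to share a chart, but [t] and the single point [ind I + ind J]
   do. *)
case: (cone_ind_common (ind I + ind J) K Af Ag) => h Ah [eh [K' eK]].
have hI := (ip_cle tI).1; have hJ := (ip_cle tJ).1.
have := @cone_concave _ _ _ _ _ bld f g (ind K) (ind I) (ind J) Af Ag.
rewrite -et hI hJ et /= => H; have {}H := H _ _.
have lt1 I0 : I0 != setT -> n.+1%:R * mean (ind K) * mean (ind I0) < n.+1%:R * mean (ind K).
  move=> hI0; rewrite gtr_pMr ?mean_ind_lt1// mulr_gt0 ?ltr0n// mean_ind_gt0//.
have {}H := H (lt1 _ I1) (lt1 _ J1).
have em : n.+1%:R * mean (ind K) = #|K'|%:R.
  have -> : mean (ind K) = mean (ind K') by have := congr1 (fun p => p.1.1) eK.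
  by rewrite mean_ind mulrCA divff ?mulr1// pnatr_eq0.
rewrite em -eK -eh (ip_cone bld)// dotvDr !dotv_ind in H.
rewrite -eK (cone_face bld Af Ah (@coarse_indI R n I J) (esym eh)).
by apply/cle_chart => //; apply: card_sum_sub.
Qed.

Lemma cle_setU t f I J : A f -> cle (cone f (ind I)) t -> cle (cone f (ind J)) t ->
  cle (cone f (ind (I :|: J))) t.
Proof.
move=> Af tI tJ; case: (tI) => g Ag [I' [K [_ _ et]]].
have [K0|K0] := eqVneq K setT.
  by rewrite et K0 (cone_setT g f); apply/cle_chart => //; apply: subsetT.
have [I1|I1] := eqVneq I set0; first by rewrite I1 set0U.
have [J1|J1] := eqVneq J set0; first by rewrite J1 setU0.
case: (cone_ind_common (ind I + ind J) K Af Ag) => h Ah [eh [K' eK]].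
have hI := (ip_cle tI).2; have hJ := (ip_cle tJ).2.
have := @cone_concave _ _ _ _ _ bld f g (ind K) (ind I) (ind J) Af Ag.
rewrite -et hI hJ et /= => H; have {}H := H _ _.
have lt1 I0 : I0 != set0 -> n.+1%:R * mean (ind K) * mean (ind I0) < n.+1%:R * mean (ind I0).
  move=> hI0; rewrite mulrAC gtr_pMr ?mean_ind_lt1// mulr_gt0 ?ltr0n// mean_ind_gt0//.
have {}H := H (lt1 _ I1) (lt1 _ J1).
have em I0 : n.+1%:R * mean (ind I0) = #|I0|%:R.
  by rewrite mean_ind mulrCA divff ?mulr1// pnatr_eq0.
rewrite !em -eK -eh (ip_cone bld)// dotvDr !dotv_ind in H.
rewrite -eK (cone_face bld Af Ah (@coarse_indU R n I J) (esym eh)).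
apply/cle_chart => //; rewrite subUset.
have hI' := subset_leq_card (subsetIr K' I); have hJ' := subset_leq_card (subsetIr K' J).
rewrite -!natrD ler_nat in H.
have eI : K' :&: I = I by apply/eqP; rewrite eqEcard subsetIr /= -(leq_add2r #|J|) (leq_trans H)// leq_add2l.
have eJ : K' :&: J = J by apply/eqP; rewrite eqEcard subsetIr /= -(leq_add2l #|I|) (leq_trans H)// leq_add2r.
by rewrite -{1}eI -{1}eJ !subsetIl.
Qed.

(** The pair [I], [J] is carried by the point [ind I + ind J], so one chart sees all three
    subspaces. *)
Lemma cle_trans q p r : cle p q -> cle q r -> cle p r.
Proof.
move=> [f Af [I [J [sub ep eq]]]] qr; case: (qr) => g Ag [_ [K [_ _ er]]].
case: (cone_ind_common (ind I + ind J) K Af Ag) => h Ah [eh [K' eK]].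
have eI : cone f (ind I) = cone h (ind I).
  have := @coarse_indI R n I J; rewrite (setIidPl sub) => /(cone_face bld Af Ah); apply.
  by rewrite eh.
have eJ : cone f (ind J) = cone h (ind J).
  have := @coarse_indU R n I J; rewrite (setUidPr sub) => /(cone_face bld Af Ah); apply.
  by rewrite eh.
move: qr; rewrite ep eq er -eK eI eJ => /cle_chart qr; apply/cle_chart => //.
exact: subset_trans (qr Ah).
Qed.

Lemma cle_anti p q : cle p q -> cle q p -> p = q.
Proof.
move=> [f Af [I [J [sub -> ->]]]] /cle_chart h; congr (cone f (ind _)).
by apply/eqP; rewrite eqEsubset sub h.
Qed.

(** A meet computed in some common chart, with default [p]. It is independent of the chart, being a
    greatest lower bound by [cle_setI]. *)
Definition cmt p q := select p (fun r => exists2 f, A f & exists I J,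
  [/\ p = cone f (ind I), q = cone f (ind J) & r = cone f (ind (I :&: J))]).

Definition cjn p q := select p (fun r => exists2 f, A f & exists I J,
  [/\ p = cone f (ind I), q = cone f (ind J) & r = cone f (ind (I :|: J))]).

Lemma cmtE f I J : A f -> cmt (cone f (ind I)) (cone f (ind J)) = cone f (ind (I :&: J)).
Proof.
move=> Af; rewrite /cmt; set P := fun r => _.
have [g Ag [I' [J' [e1 e2 ->]]]] : P (select (cone f (ind I)) P).
  by apply: (@selectP _ _ _ (cone f (ind (I :&: J)))); exists f => //; exists I, J.
apply: cle_anti; apply: cle_setI => //.
- by rewrite e1; apply/cle_chart => //; apply: subsetIl.
- by rewrite e2; apply/cle_chart => //; apply: subsetIr.
- by rewrite -e1; apply/cle_chart => //; apply: subsetIl.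
- by rewrite -e2; apply/cle_chart => //; apply: subsetIr.
Qed.

Lemma cjnE f I J : A f -> cjn (cone f (ind I)) (cone f (ind J)) = cone f (ind (I :|: J)).
Proof.
move=> Af; rewrite /cjn; set P := fun r => _.
have [g Ag [I' [J' [e1 e2 ->]]]] : P (select (cone f (ind I)) P).
  by apply: (@selectP _ _ _ (cone f (ind (I :|: J)))); exists f => //; exists I, J.
apply: cle_anti; apply: cle_setU => //.
- by rewrite -e1; apply/cle_chart => //; apply: subsetUl.
- by rewrite -e2; apply/cle_chart => //; apply: subsetUr.
- by rewrite e1; apply/cle_chart => //; apply: subsetUl.
- by rewrite e2; apply/cle_chart => //; apply: subsetUr.
Qed.

(** * The lattice of subspaces belonging to [C] *)

Section SubLattice.
Variable C : set B.
Hypothesis cvxC : convex_subcomplex d A C.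
Local Notation inC := (inC C).

(* Together with [0] and [(1, ..., 1)], the vertices of [C]. *)
Definition is_subspace p := inC p /\ exists2 f, A f & exists I, p = cone f (ind I).

Definition subspace := {p | is_subspace p}.
Implicit Types t : subspace.

Definition at_chart f I t := sval t = cone f (ind I).

Lemma subspace_inj t t' : sval t = sval t' -> t = t'.
Proof.
case: t t' => p hp [q hq] /= e; case: _ / e in hq *.
by congr exist; apply: Prop_irrelevance.
Qed.

Lemma subspace_common t t' : exists2 f, A f & exists I J, at_chart f I t /\ at_chart f J t'.
Proof.
case: t t' => p [hp [f Af [I ep]]] [q [hq [g Ag [J eq]]]].
case: (cone_ind_common (ind I) J Af Ag) => h Ah [eh [J' eJ]].
by exists h => //; exists I, J'; rewrite /at_chart /= ep eq eh eJ.
Qed.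

Lemma at_inC f I t : at_chart f I t -> inC (cone f (ind I)).
Proof. by rewrite /at_chart => <-; case: t => p []. Qed.

Lemma exists_at f I : A f -> inC (cone f (ind I)) -> exists t, at_chart f I t.
Proof.
move=> Af h; have hp : is_subspace (cone f (ind I)) by split=> //; exists f => //; exists I.
by exists (exist _ _ hp).
Qed.

Lemma at_eq f I t t' : at_chart f I t -> at_chart f I t' -> t = t'.
Proof. by rewrite /at_chart => e1 e2; apply: subspace_inj; rewrite e1 e2. Qed.

Lemma inC_setI f I J : A f -> inC (cone f (ind I)) -> inC (cone f (ind J)) ->
  inC (cone f (ind (I :&: J))).
Proof.
move=> Af hI hJ; apply: (inC_face bld cvxC Af (@coarse_indI R n I J)).
exact: (inC_add bld cvxC).
Qed.

Lemma inC_setU f I J : A f -> inC (cone f (ind I)) -> inC (cone f (ind J)) ->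
  inC (cone f (ind (I :|: J))).
Proof.
move=> Af hI hJ; apply: (inC_face bld cvxC Af (@coarse_indU R n I J)).
exact: (inC_add bld cvxC).
Qed.

Lemma subspace_mt t t' : is_subspace (cmt (sval t) (sval t')).
Proof.
case: (subspace_common t t') => f Af [I [J [e1 e2]]].
rewrite e1 e2 cmtE//; split; last by exists f => //; eexists.
by apply: inC_setI => //; apply: at_inC; eassumption.
Qed.

Lemma subspace_jn t t' : is_subspace (cjn (sval t) (sval t')).
Proof.
case: (subspace_common t t') => f Af [I [J [e1 e2]]].
rewrite e1 e2 cjnE//; split; last by exists f => //; eexists.
by apply: inC_setU => //; apply: at_inC; eassumption.
Qed.

Definition sle t t' := cle (sval t) (sval t').
Definition smt t t' : subspace := exist _ _ (subspace_mt t t').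
Definition sjn t t' : subspace := exist _ _ (subspace_jn t t').

Lemma at_mt f I J t t' : A f -> at_chart f I t -> at_chart f J t' -> at_chart f (I :&: J) (smt t t').
Proof. by move=> Af e1 e2; rewrite /at_chart /= e1 e2 cmtE. Qed.

Lemma at_jn f I J t t' : A f -> at_chart f I t -> at_chart f J t' -> at_chart f (I :|: J) (sjn t t').
Proof. by move=> Af e1 e2; rewrite /at_chart /= e1 e2 cjnE. Qed.

Lemma at_sle f I J t t' : A f -> at_chart f I t -> at_chart f J t' -> sle t t' <-> I \subset J.
Proof. by move=> Af e1 e2; rewrite /sle e1 e2; apply: cle_chart. Qed.

Lemma at_fix f v t : A f ->
  exists2 h, A h & cone h v = cone f v /\ exists I, at_chart h I t.
Proof.
case: t => p [hp [g Ag [I ep]]] Af; case: (cone_ind_common v I Af Ag) => h Ah [eh [J eJ]].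
by exists h => //; split=> //; exists J; rewrite /at_chart /= ep eJ.
Qed.

Lemma at_face f g v I t : A f -> A g -> cone f v = cone g v -> coarse v (ind I) ->
  at_chart f I t -> at_chart g I t.
Proof. by move=> Af Ag e c; rewrite /at_chart => ->; exact: (cone_face bld Af Ag c e). Qed.

Definition sdim t : R := n.+1%:R * (sval t).1.1.

Lemma at_sdim f I t : at_chart f I t -> sdim t = #|I|%:R.
Proof. by rewrite /sdim => ->; rewrite /= mean_ind mulrCA divff ?mulr1 ?pnatr_eq0. Qed.

Lemma sle_dim_eq t t' : sle t t' -> sdim t' <= sdim t -> t = t'.
Proof.
case: (subspace_common t t') => f Af [I [J [e1 e2]]] /(at_sle Af e1 e2) sub.
rewrite (at_sdim e1) (at_sdim e2) ler_nat => h.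
have eIJ : I = J by apply/eqP; rewrite eqEcard sub.
by apply: (at_eq e1); rewrite eIJ.
Qed.

Lemma sdim_mt_jn t t' : sdim (smt t t') + sdim (sjn t t') = sdim t + sdim t'.
Proof.
case: (subspace_common t t') => f Af [I [J [e1 e2]]].
rewrite (at_sdim (at_mt Af e1 e2)) (at_sdim (at_jn Af e1 e2)) (at_sdim e1) (at_sdim e2).
by rewrite -!natrD addnC cardsUI.
Qed.

Lemma sle_refl t : sle t t.
Proof. by case: (subspace_common t t) => f Af [I [_ [e1 _]]]; apply/(at_sle Af e1 e1); rewrite subxx. Qed.

Lemma sle_anti t t' : sle t t' -> sle t' t -> t = t'.
Proof. by move=> h1 h2; apply: subspace_inj; apply: cle_anti. Qed.

Lemma sle_trans t2 t1 t3 : sle t1 t2 -> sle t2 t3 -> sle t1 t3.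
Proof. exact: cle_trans. Qed.

Lemma smt_glb t1 t2 t : sle t t1 -> sle t t2 -> sle t (smt t1 t2).
Proof.
case: (subspace_common t1 t2) => f Af [I [J [e1 e2]]].
by rewrite /sle (at_mt Af e1 e2) e1 e2; apply: cle_setI.
Qed.

Lemma sjn_lub t1 t2 t : sle t1 t -> sle t2 t -> sle (sjn t1 t2) t.
Proof.
case: (subspace_common t1 t2) => f Af [I [J [e1 e2]]].
by rewrite /sle (at_jn Af e1 e2) e1 e2; apply: cle_setU.
Qed.

Lemma smt_lel t1 t2 : sle (smt t1 t2) t1.
Proof.
case: (subspace_common t1 t2) => f Af [I [J [e1 e2]]].
by apply/(at_sle Af (at_mt Af e1 e2) e1)/subsetIl.
Qed.

Lemma smt_ler t1 t2 : sle (smt t1 t2) t2.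
Proof.
case: (subspace_common t1 t2) => f Af [I [J [e1 e2]]].
by apply/(at_sle Af (at_mt Af e1 e2) e2)/subsetIr.
Qed.

Lemma sjn_lel t1 t2 : sle t1 (sjn t1 t2).
Proof.
case: (subspace_common t1 t2) => f Af [I [J [e1 e2]]].
by apply/(at_sle Af e1 (at_jn Af e1 e2))/subsetUl.
Qed.

Lemma sjn_ler t1 t2 : sle t2 (sjn t1 t2).
Proof.
case: (subspace_common t1 t2) => f Af [I [J [e1 e2]]].
by apply/(at_sle Af e2 (at_jn Af e1 e2))/subsetUr.
Qed.

(* Both sides of the modular law have the same dimension. *)
Lemma subspace_modular : modular_lattice sle smt sjn.
Proof.
split; [exact: sle_refl|exact: sle_anti|exact: sle_trans|exact: smt_lel|exact: smt_ler
  |exact: smt_glb|exact: sjn_lel|exact: sjn_ler|exact: sjn_lub|].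
move=> a b c ac.
have sub : sle (sjn a (smt b c)) (smt (sjn a b) c).
  apply: smt_glb; apply: sjn_lub => //.
  - exact: sjn_lel.
  - apply: sle_trans (smt_lel b c) _; exact: sjn_ler.
  - exact: smt_ler.
suff -> : sjn a (smt b c) = smt (sjn a b) c by exact: sle_refl.
apply: sle_dim_eq => //.
have e1 := sdim_mt_jn a (smt b c); have e2 := sdim_mt_jn (sjn a b) c.
have e3 := sdim_mt_jn b c; have e4 := sdim_mt_jn a b.
have e5 : smt a (smt b c) = smt a b.
  apply: sle_anti; apply: smt_glb; first exact: smt_lel.
  - apply: sle_trans (smt_ler _ _) _; exact: smt_lel.
  - exact: smt_lel.
  - by apply: smt_glb; [exact: smt_ler|apply: sle_trans (smt_lel _ _) ac].
have e6 : sjn (sjn a b) c = sjn b c.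
  apply: sle_anti; apply: sjn_lub.
  - apply: sjn_lub; [apply: sle_trans ac _; exact: sjn_ler|exact: sjn_lel].
  - exact: sjn_ler.
  - apply: sle_trans (sjn_ler a b) _; exact: sjn_lel.
  - exact: sjn_ler.
rewrite e5 in e1; rewrite e6 in e2; lra.
Qed.
End SubLattice.
End Lattice.

(** * Graded filtrations and the circumradius *)

Lemma exists_max_nat (P : nat -> Prop) k N : P k -> (forall m, P m -> (m <= N)%N) ->
  exists2 m, P m & forall j, P j -> (j <= m)%N.
Proof.
move=> Pk bd; have exP : exists m, `[< P m >] by exists k; apply/asboolP.
have ub m : `[< P m >] -> (m <= N)%N by move=> /asboolP/bd.
case: (ex_maxnP exP ub) => m /asboolP Pm hm; exists m => // j Pj.
by apply: hm; apply/asboolP.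
Qed.

(** * Level sets of a vector and small perturbations *)

Section Values.
Variables (R : realType) (n : nat).
Local Notation V := 'rV[R]_(n.+1).
Implicit Types (v w : V) (i j : 'I_n.+1).

(* The first index of each level set; their number is the number of distinct values. *)
Definition reps v : {set 'I_n.+1} :=
  finset (fun i => [forall j, (v ord0 j == v ord0 i) ==> (i <= j)%N]).

Lemma repsP v i j : i \in reps v -> j \in reps v -> v ord0 i = v ord0 j -> i = j.
Proof.
rewrite !inE => /forallP hi /forallP hj e; apply/val_inj/eqP; rewrite eqn_leq.
by have := hi j; have := hj i; rewrite e eqxx /= => -> ->.
Qed.

Definition rep v i := fintype.arg_min i (fun j => v ord0 j == v ord0 i) (fun j => j : nat).

Lemma repE v i : v ord0 (rep v i) = v ord0 i.
Proof. by rewrite /rep; case: arg_minnP => // r /eqP. Qed.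

Lemma rep_in v i : rep v i \in reps v.
Proof.
rewrite inE repE /rep; case: arg_minnP => // r _ hr.
by apply/forallP => j; apply/implyP; apply: hr.
Qed.

Lemma rep_eq v i j : v ord0 i = v ord0 j -> rep v i = rep v j.
Proof. by move=> e; apply: (repsP (rep_in _ _) (rep_in _ _)); rewrite !repE. Qed.

Lemma rep_id v i : i \in reps v -> rep v i = i.
Proof. by move=> hi; apply: (repsP (rep_in _ _) hi); rewrite repE. Qed.

Lemma card_reps_le v w (phi : 'I_n.+1 -> 'I_n.+1) :
  (forall i j, w ord0 (phi i) = w ord0 (phi j) -> v ord0 i = v ord0 j) ->
  (#|reps v| <= #|reps w|)%N.
Proof.
move=> h; pose k i := rep w (phi i).
have inj : {in reps v &, injective k}.
  move=> i j hi hj e; apply: (repsP hi hj); apply: h.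
  by rewrite -!(repE w (phi _)) -/(k i) e.
rewrite -(card_in_imset inj); apply: subset_leq_card.
by apply/subsetP => _ /imsetP [i _ ->]; apply: rep_in.
Qed.

(** The partition into levels of [w] refines that of [v] and has no more parts, so the two
    coincide. *)
Lemma card_reps_eq v w : (forall i j, w ord0 i = w ord0 j -> v ord0 i = v ord0 j) ->
  (#|reps w| <= #|reps v|)%N -> forall i j, v ord0 i = v ord0 j -> w ord0 i = w ord0 j.
Proof.
move=> h hle i j e.
have inj : {in reps v &, injective (rep w)}.
  move=> a b ha hb eab; apply: (repsP ha hb); apply: h.
  by rewrite -(repE w a) eab repE.
have im : rep w @: reps v = reps w.
  apply/eqP; rewrite eqEcard (card_in_imset inj) hle andbT.
  by apply/subsetP => _ /imsetP [a _ ->]; apply: rep_in.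
have /imsetP [a ha ea] : rep w i \in rep w @: reps v by rewrite im rep_in.
have /imsetP [b hb eb] : rep w j \in rep w @: reps v by rewrite im rep_in.
have e1 : w ord0 i = w ord0 a by rewrite -(repE w i) ea repE.
have e2 : w ord0 j = w ord0 b by rewrite -(repE w j) eb repE.
have eab : a = b.
  by apply: (repsP ha hb); rewrite -(h _ _ e1) -(h _ _ e2).
by rewrite e1 e2 eab.
Qed.

Lemma card_reps_Wact (s : 'S_n.+1) v : #|reps (Wact s v)| = #|reps v|.
Proof.
apply/eqP; rewrite eqn_leq; apply/andP; split.
  by apply: (@card_reps_le _ _ s) => i j; rewrite !WactE.
by apply: (@card_reps_le _ _ (s^-1)%g) => i j; rewrite !WactE !permKV.
Qed.

Lemma perturb v w : exists2 e : R, 0 < e &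
  forall i j, v ord0 i < v ord0 j -> (v + e *: w) ord0 i < (v + e *: w) ord0 j.
Proof.
case: (gap v) => g g0 hg.
pose M := \big[Order.max/0]_i `|w ord0 i|.
have M0 : 0 <= M by apply: bigmax_ge_id.
have hM i : `|w ord0 i| <= M by apply: (le_bigmax _ (fun i => `|w ord0 i|)).
have D0 : 0 < 2 * M + 1 by lra.
exists (g / (2 * M + 1)); first by rewrite divr_gt0.
move=> i j /hg h; rewrite !mxE.
have := hM i; have := hM j; rewrite !ler_norml => /andP[j1 j2] /andP[i1 i2].
suff : g / (2 * M + 1) * (w ord0 i - w ord0 j) < g by lra.
rewrite mulrAC ltr_pdivrMr// ltr_pM2l//; lra.
Qed.
End Values.

Section Graded.
Variables (R : realType) (n : nat) (B : Type) (d : B -> B -> R).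
Variable A : set ('rV[R]_(n.+1) -> B).
Hypothesis bld : building_An n d A.
Variable C : set B.
Hypothesis cvxC : convex_subcomplex d A C.
Local Notation V := 'rV[R]_(n.+1).
Local Notation ind := (ind R).
Local Notation inC := (inC C).
Local Notation mt := (smt bld cvxC).
Local Notation jn := (sjn bld cvxC).
Local Notation sle := (@sle R n B A C).
Local Notation at_chart := (@at_chart R n B A C).
Local Notation cpl := (complemented sle mt jn).
Implicit Types (f g h : V -> B) (u v w : V) (s : 'S_(n.+1)).
Implicit Types (I J K : {set 'I_n.+1}) (t : subspace A C).
Let L := subspace_modular bld cvxC.

Lemma at_coarse f v I : A f -> inC (cone f v) -> coarse v (ind I) -> exists t, at_chart f I t.
Proof. by move=> Af hv hI; apply: exists_at => //; apply: (inC_face bld cvxC Af hI). Qed.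

(* Successive quotients of the filtration [v] over an interval of weights of length
   less than one are complemented. *)
Definition graded f v :=
  forall l a b, at_chart f (up v (l + 1)) a -> at_chart f (upo v l) b -> cpl a b.

Lemma graded_change f g v : A f -> A g -> cone f v = cone g v -> graded f v -> graded g v.
Proof.
move=> Af Ag e h l a b ha hb; apply: (h l).
  by apply: (at_face bld Ag Af (esym e)) ha; apply: coarse_up.
by apply: (at_face bld Ag Af (esym e)) hb; apply: coarse_upo.
Qed.

Lemma cpl_refl a : cpl a a.
Proof.
move=> c ac ca; have -> := ml_anti L ca ac.
exists a; apply: (ml_anti L).
- exact: (mt_lbl L).
- by apply: (mt_glb L); apply: (ml_refl L).
- by apply: (jn_lub L); apply: (ml_refl L).
- exact: (jn_ubl L).
Qed.

(* [{v + w > l}] is the union of the sets [{v > l - w_i, w >= w_i}], and each of these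
   is complemented modulo [{v + w >= l + 1}] because [v] is graded. *)
Lemma graded_add f v w : A f -> inC (cone f v) -> inC (cone f w) ->
  graded f v -> graded f (v + w).
Proof.
move=> Af hv hw G l a b ha hb.
pose S i := upo v (l - w ord0 i) :&: up w (w ord0 i).
have key i : exists2 t, at_chart f (S i) t & cpl a (jn a t).
  have [p hp] := at_coarse Af hv (coarse_up (l - w ord0 i + 1) (@coarse_refl _ _ v)).
  have [q hq] := at_coarse Af hv (coarse_upo (l - w ord0 i) (@coarse_refl _ _ v)).
  have [y hy] := at_coarse Af hw (coarse_up (w ord0 i) (@coarse_refl _ _ w)).
  have hS : at_chart f (S i) (mt q y) := at_mt bld cvxC Af hq hy.
  exists (mt q y) => //; move: (mt q y) hS => t hS.
  have cpq := G _ _ _ hp hq.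
  have c1 : cpl p (jn p t).
    apply: (complemented_sub L cpq (ml_refl L _) (jn_ubl L _ _)).
    apply: (jn_lub L); first by apply/(at_sle bld Af hp hq)/subsetP => j; rewrite !inE; lra.
    by apply/(at_sle bld Af hS hq)/subsetIl.
  (* Transpose down to [[mt p t, t]]; shrink to [[mt a t, t]], since [v >= l - w_i + 1] and
     [w >= w_i] add up to [v + w >= l + 1]; then transpose up. *)
  have c2 := complemented_down L c1.
  apply: (complemented_up L); apply: (complemented_sub L c2) (mt_lbr L _ _) (ml_refl L _).
  apply/(at_sle bld Af (at_mt bld cvxC Af hp hS) (at_mt bld cvxC Af ha hS))/subsetP => j.
  by rewrite !inE !mxE => /andP[h1 /andP[h2 h3]]; rewrite h2 h3 !andbT; lra.
have all_s (s : seq 'I_n.+1) : exists2 t,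
    at_chart f (up (v + w) (l + 1) :|: finset (fun j => has (fun i => j \in S i) s)) t & cpl a t.
  elim: s => [|i s [t ht ct]].
    exists a; last exact: cpl_refl.
    by rewrite (_ : finset _ = set0) ?setU0//; apply/setP => j; rewrite !inE.
  case: (key i) => t' ht' ct'; exists (jn t (jn a t')).
    have := at_jn bld cvxC Af ht (at_jn bld cvxC Af ha ht').
    rewrite /at_chart => ->; congr (cone f (ind _)); apply/setP => j.
    have hs (s' : seq 'I_n.+1) : (j \in finset (fun j => has (fun i => j \in S i) s')) = has (fun i => j \in S i) s'.
      by rewrite inE.
    rewrite !in_setU !hs /=.
    by case: (j \in up _ _); case: (j \in S i); case: (has _ _).
  apply: (complemented_jn L) => //; last exact: (jn_ubl L).
  by apply/(at_sle bld Af ha ht)/subsetUl.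
case: (all_s (enum 'I_n.+1)) => t ht ct.
suff -> : b = t by [].
apply: (at_eq hb); rewrite /at_chart in ht *; rewrite ht; congr (cone f (ind _)).
apply/setP => j; rewrite !inE !mxE; apply/orP/idP => [[|/hasP [i _]]|hj].
- by lra.
- by rewrite !inE => /andP[]; lra.
- right; apply/hasP; exists j; first by rewrite mem_enum.
  by rewrite !inE lexx andbT; lra.
Qed.

Definition complemented_subcomplex :=
  forall f a b, A f -> at_chart f set0 a -> at_chart f setT b -> cpl a b.

(** With the most distinct values possible within [C], [v] spans a face of [C] of top dimension. *)
Definition generic f v := [/\ A f, inC (cone f v) &
  forall g w, A g -> inC (cone g w) -> (#|reps w| <= #|reps v|)%N].

Lemma exists_generic x : C x -> exists f v, generic f v.
Proof.
move=> Cx; pose P m := exists f v, [/\ A f, inC (cone f v) & #|reps v| = m].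
case: (common_chart bld x x) => f Af _.
have c0 : inC (cone f (const_mx 0)) by rewrite cone_const.
have P0 : P #|reps (const_mx 0 : V)| by exists f, (const_mx 0).
case: (exists_max_nat (N := n.+1) P0) => [m [g [w [_ _ <-]]]|m [g [w [Ag hw em]]] hm].
  by rewrite -[X in (_ <= X)%N]card_ord max_card.
by exists g, w; split=> // k z Ak hz; rewrite em; apply: hm; exists k, z.
Qed.

Lemma generic_change f g v : A g -> cone f v = cone g v -> generic f v -> generic g v.
Proof. by move=> Ag e [Af hv hm]; split=> //; rewrite -e. Qed.

(** A small move of [v] towards [w] merges no levels of [v]; by maximality it splits none either. *)
Lemma generic_const f v w : generic f v -> inC (cone f w) ->
  forall i j, v ord0 i = v ord0 j -> w ord0 i = w ord0 j.
Proof.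
move=> [Af hv hm] hw i j e; case: (perturb v w) => ep ep0 hp.
have fin a b : (v + ep *: w) ord0 a = (v + ep *: w) ord0 b -> v ord0 a = v ord0 b.
  by case: (ltgtP (v ord0 a) (v ord0 b)) => // /hp h1 h2; move: h1; rewrite h2 ltxx.
have hvw : inC (cone f (v + ep *: w)).
  by apply: (inC_add bld cvxC) => //; apply: (inC_scale bld cvxC) => //; apply: ltW.
have := card_reps_eq fin (hm _ _ Af hvw) e.
rewrite !mxE e => /addrI /(mulfI (lt0r_neq0 ep0)) //.
Qed.

(** Stretch a generic filtration until distinct values are at least one apart. An open window of
    length one then holds at most one level, which by genericity no subspace of [C] splits, so
    complements are trivial. *)
Lemma exists_graded f v : generic f v -> exists2 w, inC (cone f w) & graded f w.
Proof.
move=> gv; case: (gv) => Af hv hm; case: (gap v) => g g0 hg.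
have hgi i j : v ord0 i < v ord0 j -> g^-1 * v ord0 i + 1 <= g^-1 * v ord0 j.
  by move=> /hg h; rewrite -lerBrDl -mulrBr mulrC ler_pdivlMr// mul1r.
exists (g^-1 *: v); first by apply: (inC_scale bld cvxC) => //; rewrite invr_ge0 ltW.
move=> l a b ha hb t act tcb.
case: (at_fix bld (g^-1 *: v) t Af) => h Ah [eh [S hS]].
have {}ha : at_chart h (up (g^-1 *: v) (l + 1)) a.
  by apply: (at_face bld Af Ah (esym eh)) ha; apply: coarse_up.
have {}hb : at_chart h (upo (g^-1 *: v) l) b.
  by apply: (at_face bld Af Ah (esym eh)) hb; apply: coarse_upo.
have cvv : coarse (g^-1 *: v) v.
  by move=> i j; rewrite !mxE ler_pM2l// invr_gt0.
have gh : generic h v by apply: generic_change gv => //; apply: (cone_face bld Af Ah cvv).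
have cS := generic_const gh (at_inC hS).
have sa : up (g^-1 *: v) (l + 1) \subset S by apply/(at_sle bld Ah ha hS).
have sb : S \subset upo (g^-1 *: v) l by apply/(at_sle bld Ah hS hb).
have ab : sle a b by apply: (ml_trans L) act tcb.
have [e|ne] := eqVneq S (up (g^-1 *: v) (l + 1)).
  have -> : t = a by apply: (at_eq hS); rewrite e.
  exists b; apply: (ml_anti L); [exact: (mt_lbl L)| |by apply: (jn_lub L) => //; apply: (ml_refl L)|exact: (jn_ubr L)].
  by apply: (mt_glb L) => //; apply: (ml_refl L).
have [i iS ni] : exists2 i, i \in S & i \notin up (g^-1 *: v) (l + 1).
  have : up (g^-1 *: v) (l + 1) \proper S by rewrite properEneq eq_sym ne.
  by move=> /properP [_ [i]]; exists i.
have e : S = upo (g^-1 *: v) l.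
  apply/eqP; rewrite eqEsubset sb; apply/subsetP => j.
  have := subsetP sb _ iS; move: ni; rewrite !inE !mxE -ltNge => i1 i2 j1.
  have [j2|j2] := leP (l + 1) (g^-1 * v ord0 j).
    by apply: (subsetP sa); rewrite inE mxE.
  have eij : v ord0 i = v ord0 j.
    by case: (ltgtP (v ord0 i) (v ord0 j)) => // /hgi; lra.
  by have := cS _ _ eij; rewrite !indE iS => /eqP; rewrite eqr_nat; case: (j \in S).
have -> : t = b by apply: (at_eq hS); rewrite e.
exists a; apply: (ml_anti L); [exact: (mt_lbr L)| |by apply: (jn_lub L) => //; apply: (ml_refl L)|exact: (jn_ubl L)].
by apply: (mt_glb L) => //; apply: (ml_refl L).
Qed.

Lemma graded_spread f v : A f -> graded f v -> ~ complemented_subcomplex ->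
  exists i j, 1 <= v ord0 i - v ord0 j.
Proof.
move=> Af G; apply: contra_notP => H g a b Ag ha hb.
case: (@arg_minP _ _ _ (ord0 : 'I_n.+1) xpredT (fun i => v ord0 i)) => // i _ hi.
case: (@arg_maxP _ _ _ (ord0 : 'I_n.+1) xpredT (fun i => v ord0 i)) => // j _ hj.
have hij : v ord0 j - v ord0 i < 1.
  by rewrite ltNge; apply/negP => h; apply: H; exists j, i.
(* The open window of length one centred midway between the extreme values contains all of them. *)
pose l := (v ord0 i + v ord0 j - 1) / 2.
apply: (G l).
  rewrite (_ : up _ _ = set0); first by rewrite /at_chart (cone_set0 f g).
  apply/setP => k; rewrite !inE; apply/negbTE; rewrite -ltNge.
  by have : v ord0 k <= v ord0 j := hj k isT; rewrite /l; lra.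
rewrite (_ : upo _ _ = setT); first by rewrite /at_chart (cone_setT f g).
apply/setP => k; rewrite !inE.
by have : v ord0 i <= v ord0 k := hi k isT; rewrite /l; lra.
Qed.

(** From [a ^+ 2 + b ^+ 2 >= (a - b) ^+ 2 / 2]; this keeps the norms of graded filtrations away from
    zero. *)
Lemma dotv_cen_spread v i j : 1 <= v ord0 i - v ord0 j -> 2^-1 <= dotv (cen v) (cen v).
Proof.
move=> h; have ij : i != j by apply: contraTneq h => ->; rewrite subrr ler10.
rewrite /dotv (bigD1 i)//= (bigD1 j) 1?eq_sym//=.
have : 0 <= \sum_(k | (k != i) && (k != j)) cen v ord0 k * cen v ord0 k.
  by apply: sumr_ge0 => k _; rewrite -expr2 sqr_ge0.
have e : v ord0 i - v ord0 j = cen v ord0 i - cen v ord0 j by rewrite !mxE; ring.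
rewrite e in h; move: h; move: (cen v ord0 i) (cen v ord0 j) (\sum_(_ | _) _) => a b S.
by move=> h1 h2; have := sqr_ge0 (a + b); have := sqr_ge0 (a - b - 1); rewrite !expr2; nra.
Qed.

(* A near-minimiser of the norm among graded filtrations: moving it towards any point
   of [C] keeps it graded, hence does not shorten it. *)
Lemma exists_near_center x0 (e : R) : C x0 -> ~ complemented_subcomplex -> 0 < e ->
  exists2 y, C y & forall x, C x -> - e <= cos (d x y).
Proof.
move=> Cx0 nc e0.
pose E : set R := fun r => exists f v, [/\ A f, inC (cone f v), graded f v & r = dotv (cen v) (cen v)].
have E2 r : E r -> 2^-1 <= r.
  move=> [f [v [Af hv G ->]]]; case: (graded_spread Af G nc) => i [j].
  exact: dotv_cen_spread.
have lbE : has_lbound E by exists 2^-1 => r /E2.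
have hE : has_inf E.
  split=> //; case: (exists_generic Cx0) => f [v gv]; case: (gv) => Af _ _.
  by case: (exists_graded gv) => w hw G; exists (dotv (cen w) (cen w)), f, w.
(* [a] is the length of the move towards [x] and [a ^+ 2] the error allowed in the infimum:
   expanding the squared norm after the move gives [r * cos (d x y) > - a], and [r >= 1 / 2] turns
   this into the bound [- e]. *)
pose a := e / 2; have a0 : 0 < a by rewrite divr_gt0.
case: (inf_adherent (exprn_gt0 2 a0) hE) => _ [f [v [Af hv G ->]]] hm.
have v2 : 2^-1 <= dotv (cen v) (cen v) by apply: E2; exists f, v.
case: (polar v) => [[c ev]|[c [r [u [r0 hu ev]]]]].
  have : dotv (cen v) (cen v) = 0 by rewrite ev cen_const /dotv big1// => i _; rewrite mxE mul0r.
  by move=> z; rewrite z in v2; lra.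
have cv : cen v = r *: u by rewrite ev cenD cenZ cen_const cen_SA// add0r.
have [hu1 _] := hu.
have er : dotv (cen v) (cen v) = r * r by rewrite cv dotvZl dotvZr hu1 mulr1.
have r2 : 2^-1 <= r by rewrite er in v2; nra.
exists (f u); first by move: hv; rewrite ev cone_polar.
move=> x Cx; case: (common_chart bld x x) => k Ak [q [_ [hq _ ex _]]].
pose w := const_mx 0 + 1 *: q.
have ew : cone k w = (0, 1, Some x) by rewrite cone_polar// ex.
case: (cone_common bld v w Af Ak) => h Ah [ehv [s ehw]].
have hsq : SA n (Wact s q) by exact: Wact_SA.
have es : Wact s w = const_mx 0 + 1 *: Wact s q by rewrite WactD WactZ Wact_const.
have hx : h (Wact s q) = x by move: ehw; rewrite es ew cone_polar// => -[].
have hy : h u = f u by move: ehv; rewrite ev !cone_polar// => -[].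
have Gh : graded h v by exact: (graded_change Af Ah).
have hvh : inC (cone h v) by rewrite ehv.
have hwh : inC (cone h (a *: Wact s w)).
  by apply: (inC_scale bld cvxC) => //; [exact: ltW|rewrite ehw ew].
have : E (dotv (cen (v + a *: Wact s w)) (cen (v + a *: Wact s w))).
  exists h, (v + a *: Wact s w); split=> //; last exact: graded_add.
  exact: (inC_add bld cvxC).
move=> /(ge_inf lbE) hinf; have [hs1 _] := hsq.
rewrite -hx -hy (chart_isom bld)// cos_sdist//.
have eW : cen (Wact s w) = Wact s q by rewrite es cenD cenZ cen_const cen_SA// add0r scale1r.
rewrite cenD cenZ eW cv !(dotvDl, dotvDr, dotvZl, dotvZr) hu1 hs1 (dotvC u) in hinf.
rewrite er in hm; move: hinf hm; move: (inf E) (dotv _ u) => m D hinf hm.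
have ea : e = 2 * a by rewrite /a; field.
have h1 : - a < r * D by nra.
rewrite ea; nra.
Qed.

(** As [cos (pi / 2 + t) = - sin t], a near centre for the error [sin t] has radius at most
    [pi / 2 + t]; [t <= pi / 4] keeps this where the cosine is decreasing. *)
Lemma circumradius_le_pihalf x0 : C x0 -> ~ complemented_subcomplex ->
  (circumradius d C <= (pi / 2)%:E)%E.
Proof.
move=> Cx0 nc; apply/lee_addgt0Pr => e e0.
have pi2 := @pi_ge2 R.
pose t := Order.min e (pi / 4); have pi4 : 0 < pi / 4 :> R by lra.
have t0 : 0 < t by rewrite lt_min e0.
have te : t <= e by rewrite ge_min lexx.
have tp : t <= pi / 4 by rewrite ge_min lexx orbT.
have s0 : 0 < sin t by apply: sin_gt0_pi; apply/andP; split; lra.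
case: (exists_near_center Cx0 nc s0) => y Cy hy.
apply: (@ereal.ge_ereal_inf); exists (ereal_sup [set (d x y)%:E | x in C]%classic); first by exists y.
apply: ge_ereal_sup => _ [x Cx <-]; rewrite -EFinD lee_fin.
apply: le_trans (_ : pi / 2 + t <= _); last by rewrite lerD2l.
rewrite leNgt; apply/negP => h; have := hy _ Cx; rewrite leNgt => /negP; apply.
rewrite -cosDpihalf addrC ltr_cos//; rewrite in_itv/= ?(dist_bounds bld)//.
by apply/andP; split; lra.
Qed.
End Graded.

(** * Opposite filtrations in the complemented case *)

Section Frame.
Variables (R : realType) (n : nat) (B : Type) (d : B -> B -> R).
Variable A : set ('rV[R]_(n.+1) -> B).
Hypothesis bld : building_An n d A.
Variable C : set B.
Hypothesis cvxC : convex_subcomplex d A C.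
Local Notation V := 'rV[R]_(n.+1).
Local Notation ind := (ind R).
Local Notation inC := (inC C).
Local Notation mt := (smt bld cvxC).
Local Notation jn := (sjn bld cvxC).
Local Notation sle := (@sle R n B A C).
Local Notation at_chart := (@at_chart R n B A C).
Local Notation sdim := (@sdim R n B A C).
Local Notation generic := (generic A C).
Local Notation cpl := (complemented sle mt jn).
Implicit Types (f g h : V -> B) (u v w : V) (s : 'S_(n.+1)).
Implicit Types (I J K : {set 'I_n.+1}) (t : subspace A C) (i j : 'I_n.+1).
Let L := subspace_modular bld cvxC.

(** A small move of [u] towards a generic vector separates all values which that vector separates,
    and keeps [u] in the closed face of the result. *)
Lemma generic_refine f u g z : A f -> inC (cone f u) -> generic g z ->
  exists h v, [/\ generic h v, cone h u = cone f u & coarse v u].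
Proof.
move=> Af hu [Ag hz hm]; case: (cone_common bld u z Af Ag) => h Ah [eh [s es]].
case: (perturb u (Wact s z)) => e e0 he.
have cvu : coarse (u + e *: Wact s z) u.
  by move=> i j; rewrite !leNgt; apply: contra => /he.
exists h, (u + e *: Wact s z); split=> //; split=> //.
  apply: (inC_add bld cvxC) => //; first by rewrite eh.
  by apply: (inC_scale bld cvxC) => //; [exact: ltW|rewrite es].
move=> k w Ak hw; apply: leq_trans (hm _ _ Ak hw) _.
rewrite -(card_reps_Wact s); apply: (@card_reps_le _ _ _ _ id) => i j e1.
have e2 := coarse_eq cvu e1.
have E k0 : (u + e *: Wact s z) ord0 k0 = u ord0 k0 + e * Wact s z ord0 k0 by rewrite !mxE.
by move: e1; rewrite !E e2 => /addrI /(mulfI (lt0r_neq0 e0)).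
Qed.

(** In a common chart the two points differ by a permutation; it preserves every superlevel set of
    [w], hence [w] itself. *)
Lemma cone_up_inj f h w : A f -> A h ->
  (forall l, cone f (ind (up w l)) = cone h (ind (up w l))) -> cone f w = cone h w.
Proof.
move=> Af Ah H; case: (cone_common bld w w Af Ah) => k Ak [e1 [s e2]].
case: (cone_change bld Ah Ak) => t ht.
have eup l : up w l = t @^-1: up w l.
  apply: (@ind_inj R); rewrite -Wact_ind; apply: ht; rewrite -H.
  by apply: (cone_face bld Af Ak) (esym e1); apply: coarse_up.
have ew : Wact t w = w.
  apply/rowP => i; rewrite WactE; apply/eqP; rewrite eq_le; apply/andP; split.
    by have : i \in t @^-1: up w (w ord0 (t i)) by [rewrite !inE]; rewrite -eup inE.
  by have : i \in up w (w ord0 i) by [rewrite inE]; rewrite eup !inE.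
by rewrite -e2 (ht w (Wact s w))// ew e1.
Qed.

(** The coordinate of [v] at [j] counts the members of the chain containing [j]. A new member
    contains the support of [v], so adding its indicator leaves the earlier ones in the closed
    face. *)
Lemma chain_chart (c : nat -> subspace A C) f0 m : A f0 -> (forall k, sle (c k) (c k.+1)) ->
  exists f v, [/\ A f, forall j, 0 <= v ord0 j,
    forall j, 0 < v ord0 j -> exists k I, [/\ (k < m)%N, at_chart f I (c k) & j \in I] &
    forall k, (k < m)%N -> exists2 I, at_chart f I (c k) & coarse v (ind I)].
Proof.
move=> Af0 hc.
have mono k l : (k <= l)%N -> sle (c k) (c l).
  elim: l => [|l IH]; first by rewrite leqn0 => /eqP ->; apply: (ml_refl L).
  rewrite leq_eqVlt => /orP[/eqP ->|]; first exact: (ml_refl L).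
  by rewrite ltnS => /IH h; apply: (ml_trans L) h _.
elim: m => [|m [f [v [Af v0 vs vc]]]].
  by exists f0, 0; split=> // j; rewrite mxE ?ltxx.
case: (at_fix bld v (c m) Af) => h Ah [eh [J hJ]].
have sub k I : (k < m)%N -> at_chart h I (c k) -> I \subset J.
  by move=> km hI; apply/(at_sle bld Ah hI hJ)/mono/ltnW.
have vc' k : (k < m)%N -> exists2 I, at_chart h I (c k) & coarse v (ind I).
  move=> /vc [I hI cI]; exists I => //; exact: (at_face bld Af Ah (esym eh) cI).
have vJ j : 0 < v ord0 j -> j \in J.
  move=> /vs [k [I [km hI jI]]]; case: (vc' _ km) => I' hI' cI'.
  have := vc _ km => -[I2 hI2 cI2].
  have e2 : I = I2 by apply: (@ind_inj R); apply: (cone_inj bld Af); rewrite -hI -hI2.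
  apply: (subsetP (sub _ _ km (at_face bld Af Ah (esym eh) cI2 hI2))).
  by rewrite -e2.
have vE j : (v + ind J) ord0 j = v ord0 j + (j \in J)%:R by rewrite mxE indE.
exists h, (v + ind J); split=> //.
- by move=> j; rewrite vE addr_ge0// ler0n.
- move=> j; rewrite vE; case jJ : (j \in J); first by exists m, J.
  by rewrite addr0 => /vJ; rewrite jJ.
- move=> k; rewrite ltnS leq_eqVlt => /orP[/eqP ->|km].
    exists J => //; apply: coarse_ind => i j; rewrite !vE => + iJ; rewrite iJ.
    case jJ : (j \in J) => //; rewrite addr0 => h1.
    have : 0 < v ord0 j by apply: lt_le_trans h1; rewrite ltr_wpDl.
    by move/vJ; rewrite jJ.
  case: (vc' _ km) => I hI cI; exists I => //; apply: coarse_ind => i j; rewrite !vE => h1 iI.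
  have iJ := subsetP (sub _ _ km hI) _ iI; rewrite iJ in h1.
  have h2 : v ord0 i <= v ord0 j by move: h1; case: (j \in J) => /=; lra.
  have := cI _ _ h2; rewrite !indE iI; case: (j \in I) => //=.
  by rewrite lern0.
Qed.

Lemma chain_common (c : nat -> subspace A C) f v m : A f -> (forall k, sle (c k) (c k.+1)) ->
  exists2 h, A h & cone h v = cone f v /\ forall k, (k < m)%N -> exists I, at_chart h I (c k).
Proof.
move=> Af hc; case: (chain_chart m Af hc) => g [z [Ag _ _ hz]].
case: (cone_common bld v z Af Ag) => h Ah [eh [s es]]; exists h => //; split=> // k km.
case: (hz _ km) => I hI cI; exists (s @^-1: I).
have As := chart_Wact bld s Ah.
have e : cone g z = cone (h \o Wact s) z by rewrite cone_Wact es.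
by have := at_face bld Ag As e cI hI; rewrite /at_chart cone_Wact Wact_ind.
Qed.

Section Rank.
Variable v : V.
(** Numbers the levels of [v] for induction. Numbers may be skipped, and [rk_eq] is then empty. *)
Definition rk i : nat := #|finset (fun j => v ord0 j < v ord0 i)|.
Definition rk_ge k : {set 'I_n.+1} := finset (fun i => k <= rk i)%N.
Definition rk_lt k : {set 'I_n.+1} := finset (fun i => rk i < k)%N.
Definition rk_eq k : {set 'I_n.+1} := finset (fun i => rk i == k).

Lemma rk_le i j : (rk i <= rk j)%N = (v ord0 i <= v ord0 j).
Proof.
apply/idP/idP => h.
  rewrite leNgt; apply/negP => ji; move: h; rewrite leqNgt => /negP; apply.
  apply: proper_card; apply/properP; split.
    by apply/subsetP => k; rewrite !inE => /lt_trans; apply.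
  by exists j; rewrite !inE ?ltxx.
by apply: subset_leq_card; apply/subsetP => k; rewrite !inE => /lt_le_trans; apply.
Qed.

Lemma rk_eqE i j : (rk i == rk j) = (v ord0 i == v ord0 j).
Proof. by rewrite eqn_leq !rk_le eq_le. Qed.

Lemma coarse_rk_ge k : coarse v (ind (rk_ge k)).
Proof. by apply: coarse_ind => i j; rewrite -rk_le !inE => h1 h2; apply: leq_trans h1. Qed.

Lemma rk_bound i : (rk i < n.+1)%N.
Proof.
rewrite /rk -[X in (_ < X)%N]card_ord -cardsT; apply: proper_card; apply/properP.
by split; [exact: subsetT|exists i; rewrite ?inE ?ltxx].
Qed.
End Rank.

(* For charts containing two generic filtrations, and with every subspace of C complemented
   in C, replace the chart by one in which all unions of level sets of [v] belong to C. *)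
Section Opposite.
Variables (f : V -> B) (v w : V).
Hypotheses (gv : generic f v) (gw : generic f w).
Hypothesis cplC : complemented_subcomplex bld cvxC.

Let Af : A f. Proof. by case: gv. Qed.
Let hv : inC (cone f v). Proof. by case: gv. Qed.
Let hw : inC (cone f w). Proof. by case: gw. Qed.

Lemma exists_bot : exists t, at_chart f set0 t.
Proof.
apply: exists_at => //; have -> : ind set0 = const_mx 0 :> V by apply/rowP => i; rewrite !mxE inE.
by rewrite cone_const.
Qed.

Lemma exists_top : exists t, at_chart f setT t.
Proof.
apply: exists_at => //; have -> : ind setT = const_mx 1 :> V by apply/rowP => i; rewrite !mxE inE.
by rewrite cone_const.
Qed.

(** A complement of [rk_ge v k.+1] in [rk_ge v k]. By genericity [w] is constant on the level, and
    the complement is taken inside the step of [w] at that value, which adapts the splitting to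
    [w]. *)
Lemma exists_piece k : exists a : subspace A C, [/\ sdim a = #|rk_eq v k|%:R,
  forall x y, at_chart f (rk_ge v k) x -> at_chart f (rk_ge v k.+1) y ->
    sle x (jn y a) /\ sle a x &
  forall j y, rk v j = k -> at_chart f (up w (w ord0 j)) y -> sle a y].
Proof.
case: exists_bot => bo hbo; case: exists_top => to hto.
have [e0|/set0Pn [j]] := eqVneq (rk_eq v k) set0.
  exists bo; split.
  - by rewrite (at_sdim hbo) e0.
  - have e : rk_ge v k = rk_ge v k.+1.
      apply/setP => i; rewrite !inE leq_eqVlt; case: eqP => //= ei.
      by have : i \in rk_eq v k by [rewrite inE ei]; rewrite e0 inE.
    rewrite e => x y hx hy; split.
      by apply/(at_sle bld Af hx (at_jn bld cvxC Af hy hbo))/subsetUl.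
    by apply/(at_sle bld Af hbo hx)/sub0set.
  - by move=> j y _ hy; apply/(at_sle bld Af hbo hy)/sub0set.
rewrite inE => /eqP rj.
have wj i : rk v i = k -> w ord0 i = w ord0 j.
  move=> ri; apply: (generic_const bld cvxC gv hw); apply/eqP.
  by rewrite -rk_eqE ri rj.
have [x0 hx0] := at_coarse bld cvxC Af hv (@coarse_rk_ge v k).
have [y0 hy0] := at_coarse bld cvxC Af hv (@coarse_rk_ge v k.+1).
have [z0 hz0] := at_coarse bld cvxC Af hw (coarse_up (w ord0 j) (@coarse_refl _ _ w)).
have hp := at_mt bld cvxC Af hx0 hz0; have hq := at_mt bld cvxC Af hy0 hz0.
have qp : sle (mt y0 z0) (mt x0 z0).
  by apply/(at_sle bld Af hq hp)/setSI/subsetP => i; rewrite !inE => /ltnW.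
have bq : sle bo (mt y0 z0) by apply/(at_sle bld Af hbo hq)/sub0set.
have bp : sle bo (mt x0 z0) by apply: (ml_trans L) bq qp.
have pt : sle (mt x0 z0) to by apply/(at_sle bld Af hp hto)/subsetT.
have c1 := complemented_sub L (cplC Af hbo hto) (ml_refl L bo) bp pt.
case: (c1 _ bq qp) => a a1 a2; exists a.
have ap : sle a (mt x0 z0) by rewrite -a2; apply: (jn_ubr L).
have eU : rk_ge v k :&: up w (w ord0 j) = (rk_ge v k.+1 :&: up w (w ord0 j)) :|: rk_eq v k.
  apply/setP => i; rewrite !inE leq_eqVlt eq_sym; case: eqP => /= [/wj ->|_].
    by rewrite lexx orbT.
  by rewrite orbF.
have dI : (rk_ge v k.+1 :&: up w (w ord0 j)) :&: rk_eq v k = set0.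
  apply/setP => i; rewrite !inE; case: eqP => [->|]; last by rewrite andbF.
  by rewrite ltnn.
split.
- have := sdim_mt_jn bld cvxC (mt y0 z0) a.
  rewrite a1 a2 (at_sdim hbo) (at_sdim hp) (at_sdim hq) cards0 add0r eU.
  by rewrite cardsU dI cards0 subn0 natrD => /addrI.
- move=> x y hx hy; have -> : x = x0 by apply: (at_eq hx).
  have -> : y = y0 by apply: (at_eq hy).
  split; last by apply: (ml_trans L) ap (mt_lbl L _ _).
  apply: (ml_trans L (b := jn y0 (mt x0 z0))).
    apply/(at_sle bld Af hx0 (at_jn bld cvxC Af hy0 hp))/subsetP => i.
    rewrite eU !inE leq_eqVlt eq_sym => /orP[/eqP ->|->//].
    by rewrite eqxx !orbT.
  apply: (jn_lub L); first exact: (jn_ubl L).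
  rewrite -a2; apply: (jn_lub L); last exact: (jn_ubr L).
  by apply: (ml_trans L) (mt_lbl L _ _) (jn_ubl L _ _).
- move=> i y /wj ei; rewrite ei => hy; have -> : y = z0 by apply: (at_eq hy).
  by apply: (ml_trans L) ap (mt_lbr L _ _).
Qed.

(** [Z k], the join of the pieces below level [k], is the opposite filtration. Together with
    [rk_ge v k] it spans everything, and its dimension leaves no slack, so a chart holding [v] and
    the chain [Z] shows [Z k] as [rk_lt v k] and each piece as a level set. *)
Lemma exists_frame : exists2 h, A h & [/\ cone h v = cone f v, cone h w = cone f w &
  forall u, (forall i j, v ord0 i = v ord0 j -> u ord0 i = u ord0 j) -> inC (cone h u)].
Proof.
case: exists_bot => bo hbo; case: exists_top => to hto.
case: (choice exists_piece) => a ha.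
pose Z := fix Z k := if k is k'.+1 then jn (Z k') (a k') else bo.
have Zc k : sle (Z k) (Z k.+1) by apply: (jn_ubl L).
have hX k := at_coarse bld cvxC Af hv (@coarse_rk_ge v k).
have Ztop k x : at_chart f (rk_ge v k) x -> sle to (jn (Z k) x).
  elim: k x => [|k IH] y hy.
    have -> : y = to by apply: (at_eq hy); rewrite (_ : rk_ge v 0 = setT)//; apply/setP => i; rewrite !inE.
    exact: (jn_ubr L).
  case: (hX k) => x hx; case: (ha k) => _ /(_ _ _ hx hy) [xy _] _.
  apply: (ml_trans L (IH _ hx)); apply: (jn_lub L).
    by apply: (ml_trans L) (jn_ubl L _ _); apply: (jn_ubl L).
  apply: (ml_trans L xy); apply: (jn_lub L); first exact: (jn_ubr L).
  by apply: (ml_trans L) (jn_ubl L _ _); apply: (jn_ubr L).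
have Zdim k : sdim (Z k) <= #|rk_lt v k|%:R.
  elim: k => [|k IH]; first by rewrite (at_sdim hbo) cards0 ler0n.
  have := sdim_mt_jn bld cvxC (Z k) (a k); case: (ha k) => -> _ _ e.
  have d0 t : 0 <= sdim t.
    by case: (subspace_common bld t t) => g _ [I [_ [e1 _]]]; rewrite (at_sdim e1).
  have := d0 (mt (Z k) (a k)).
  have -> : #|rk_lt v k.+1| = (#|rk_lt v k| + #|rk_eq v k|)%N.
    have -> : rk_lt v k.+1 = rk_lt v k :|: rk_eq v k.
      by apply/setP => i; rewrite !inE ltnS leq_eqVlt orbC.
    rewrite cardsU (_ : _ :&: _ = set0) ?cards0 ?subn0//.
    by apply/setP => i; rewrite !inE; case: eqP => [->|]; rewrite ?ltnn ?andbF.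
  by rewrite natrD /=; move: e IH; lra.
(* Ranks run up to [n], and the piece of level [n] is cut out by [Z n.+1], hence [n.+2] members. *)
case: (chain_common v n.+2 Af Zc) => h Ah [eh hZ].
have toh k x : at_chart f (rk_ge v k) x -> at_chart h (rk_ge v k) x.
  by apply: (at_face bld Af Ah (esym eh)); apply: coarse_rk_ge.
have htoh : at_chart h setT to by rewrite /at_chart hto; apply: cone_setT.
have Zh k : (k < n.+2)%N -> at_chart h (rk_lt v k) (Z k).
  move=> kn; case: (hZ _ kn) => I hI; case: (hX k) => x hx.
  have := Ztop _ _ hx; move/(at_sle bld Ah htoh (at_jn bld cvxC Ah hI (toh _ _ hx))) => hT.
  suff -> : rk_lt v k = I by [].
  apply/eqP; rewrite eqEcard -(ler_nat R) -(at_sdim hI) Zdim andbT.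
  apply/subsetP => i; rewrite inE => ik; have := subsetP hT i; rewrite !inE => /(_ isT).
  by rewrite leqNgt ik orbF.
have ah k : (k < n.+1)%N -> at_chart h (rk_eq v k) (a k).
  move=> kn; case: (hX k) => x hx; case: (hX k.+1) => y hy.
  case: (ha k) => da /(_ _ _ hx hy) [_ ax] _.
  have e : rk_eq v k = rk_lt v k.+1 :&: rk_ge v k.
    by apply/setP => i; rewrite !inE ltnS eqn_leq.
  have hm := at_mt bld cvxC Ah (Zh k.+1 kn) (toh _ _ hx).
  suff -> : a k = mt (Z k.+1) x by rewrite e.
  apply: sle_dim_eq; first exact: bld.
    by apply: (mt_glb L) => //; apply: (jn_ubr L).
  by rewrite (at_sdim hm) -e da.
pose U (r : seq 'I_n.+1) : {set 'I_n.+1} := finset (fun j => has (fun i => v ord0 j == v ord0 i) r).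
have Uc i r : U (i :: r) = rk_eq v (rk v i) :|: U r.
  by apply/setP => j; rewrite !inE /= rk_eqE.
have hU (r : seq 'I_n.+1) t : (forall i, i \in r -> sle (a (rk v i)) t) ->
    exists2 t', at_chart h (U r) t' & sle t' t.
  elim: r => [|i r IH] hr.
    have bt : at_chart h (U [::]) bo.
      rewrite (_ : U _ = set0); first by rewrite /at_chart hbo; apply: cone_set0.
      by apply/setP => j; rewrite !inE.
    exists bo => //; case: (at_fix bld 0 t Ah) => g Ag [_ [I hI]].
    have bg : at_chart g set0 bo by rewrite /at_chart hbo; apply: cone_set0.
    by apply/(at_sle bld Ag bg hI)/sub0set.
  case: IH => [j jr|t' ht' tt]; first by apply: hr; rewrite inE jr orbT.
  exists (jn (a (rk v i)) t').
    by rewrite Uc; apply: (at_jn bld cvxC Ah) => //; apply/ah/rk_bound.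
  by apply: (jn_lub L) => //; apply: hr; rewrite inE eqxx.
have UE I : (forall i j, v ord0 i = v ord0 j -> i \in I -> j \in I) -> I = U (enum I).
  move=> hI; apply/setP => j; rewrite inE; apply/idP/hasP => [jI|[i]].
    by exists j; rewrite ?mem_enum.
  by rewrite mem_enum => iI /eqP e; apply: hI iI.
(* A step of [w] contains the pieces of its levels and has their total dimension, so it is their
   join in the new chart too. *)
have eup l : cone f (ind (up w l)) = cone h (ind (up w l)).
  have [y hy] := at_coarse bld cvxC Af hw (coarse_up l (@coarse_refl _ _ w)).
  have [t' ht' ty] : exists2 t', at_chart h (U (enum (up w l))) t' & sle t' y.
    apply: hU => i; rewrite mem_enum inE => il.
    have [z hz] := at_coarse bld cvxC Af hw (coarse_up (w ord0 i) (@coarse_refl _ _ w)).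
    case: (ha (rk v i)) => _ _ /(_ i z erefl hz) h1; apply: (ml_trans L h1).
    by apply/(at_sle bld Af hz hy)/subsetP => j; rewrite !inE; apply: le_trans.
  rewrite -UE in ht'; last first.
    by move=> i j /(generic_const bld cvxC gv hw) e; rewrite !inE e.
  rewrite -hy -ht'; congr (sval _); apply/esym; apply: (sle_dim_eq bld ty).
  by rewrite (at_sdim hy) (at_sdim ht').
exists h => //; split=> //; first by apply/esym/cone_up_inj.
move=> u hu.
have hI I : (forall i j, v ord0 i = v ord0 j -> i \in I -> j \in I) -> inC (cone h (ind I)).
  move=> /UE ->; case: (hU (enum I) to) => [i _|t' ht' _]; last exact: at_inC ht'.
  case: (at_fix bld 0 (a (rk v i)) Ah) => g Ag [_ [J hJ]].
  have tg : at_chart g setT to by rewrite /at_chart hto; apply: cone_setT.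
  by apply/(at_sle bld Ag hJ tg)/subsetT.
case: (@arg_minP _ _ _ (ord0 : 'I_n.+1) xpredT (fun i => u ord0 i)) => // i0 _ hi0.
pose bl i : {set 'I_n.+1} := finset (fun j => v ord0 j == v ord0 i).
(* Subtracting the minimum makes the coefficients nonnegative, as [inC_scale] requires. *)
have -> : u = const_mx (u ord0 i0) + \sum_(r in reps v) (u ord0 r - u ord0 i0) *: ind (bl r).
  apply/rowP => j; rewrite mxE summxE mxE (bigD1 (rep v j)) ?rep_in//= big1.
    by rewrite mxE indE inE repE eqxx mulr1 (hu _ _ (repE v j)); ring.
  move=> r /andP[hr rj]; rewrite mxE indE inE.
  case: eqP => [e|]; last by rewrite mulr0.
  by case/eqP: rj; rewrite (rep_eq e) rep_id.
apply: (inC_add bld cvxC) => //; first by rewrite cone_const.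
elim/big_ind: _ => [|x y|r _].
- by rewrite (_ : 0 = const_mx 0) ?cone_const//; apply/rowP => j; rewrite !mxE.
- exact: (inC_add bld cvxC).
- apply: (inC_scale bld cvxC) => //; first by rewrite subr_ge0; apply: hi0.
  by apply: hI => i j e; rewrite !inE e.
Qed.
End Opposite.
End Frame.

(** * Block-constant vectors *)

Section Orthonormal.
Variables (R : realType) (N : nat).

Lemma dotv_mulmx (x y : 'rV[R]_N) : dotv x y = (x *m y^T) ord0 ord0.
Proof. by rewrite mxE; apply: eq_bigr => i _; rewrite mxE. Qed.

(** Gram-Schmidt: the first row loses its projection [a *m Q^T *m Q] to the others and is
    normalised. *)
Lemma exists_orthonormal r (M : 'M[R]_(r, N)) : row_free M ->
  exists Q : 'M[R]_(r, N), [/\ Q *m Q^T = 1%:M, (Q <= M)%MS & (M <= Q)%MS].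
Proof.
elim: r M => [|r IH] M fM.
  by exists M; rewrite !submx_refl; split=> //; apply/matrixP => -[].
pose a := usubmx (M : 'M[R]_(1 + r, N)); pose M' := dsubmx (M : 'M[R]_(1 + r, N)).
have eM : M = col_mx a M' by rewrite vsubmxK.
have inj (x : 'rV[R]_(1 + r)) : x *m col_mx a M' = 0 -> x = 0.
  by rewrite -eM => h; apply: (row_free_inj fM); rewrite h mul0mx.
have fM' : row_free M'.
  apply: inj_row_free => x h; have := inj (row_mx 0 x).
  rewrite mul_row_col mul0mx add0r h => /(_ erefl) e.
  by have := congr1 rsubmx e; rewrite row_mxKr linear0.
case: (IH _ fM') => Q [QQ QM MQ].
pose b := a - a *m Q^T *m Q.
have bQ : b *m Q^T = 0 by rewrite mulmxBl -(mulmxA (a *m _)) QQ mulmx1 subrr.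
have b0 : dotv b b != 0.
  apply/eqP => /dotv_eq0 /eqP; rewrite subr_eq0 => /eqP ea.
  have /submxP [D eD] : (a <= M')%MS by rewrite ea; apply: submx_trans QM; apply: submxMl.
  have := inj (row_mx 1%:M (- D)); rewrite mul_row_col mul1mx mulNmx -eD subrr => /(_ erefl).
  move=> /(congr1 lsubmx); rewrite row_mxKl linear0 => /matrixP /(_ ord0 ord0).
  by rewrite !mxE eqxx => /eqP; rewrite oner_eq0.
have b1 : 0 < dotv b b by rewrite lt_def b0 dotv_ge0.
pose c := (Num.sqrt (dotv b b))^-1.
have c0 : c != 0 by rewrite invr_eq0 gt_eqF// sqrtr_gt0.
have cbb : (c *: b) *m (c *: b)^T = 1%:M.
  apply/matrixP => i j; rewrite !ord1 -dotv_mulmx dotvZl dotvZr mulrA mxE eqxx.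
  by rewrite /c -invfM -expr2 sqr_sqrtr ?dotv_ge0// mulVf.
have ? : exists Q2 : 'M[R]_(1 + r, N),
    [/\ Q2 *m Q2^T = 1%:M, (Q2 <= col_mx a M')%MS & (col_mx a M' <= Q2)%MS]; last by rewrite eM.
have [sa sM] : (a <= col_mx a M')%MS /\ (M' <= col_mx a M')%MS.
  by move: (submx_refl (col_mx a M')); rewrite {1}col_mx_sub => /andP[].
exists (col_mx (c *: b) Q); split.
- rewrite tr_col_mx mul_col_row cbb QQ -scalemxAl bQ scaler0.
  have -> : Q *m (c *: b)^T = 0.
    by apply: trmx_inj; rewrite trmx_mul trmxK -scalemxAl bQ scaler0 linear0.
  by rewrite -scalar_mx_block.
- rewrite col_mx_sub; apply/andP; split; last exact: submx_trans QM sM.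
  apply: scalemx_sub; apply: addmx_sub => //; rewrite eqmx_opp.
  exact: submx_trans (submxMl _ _) (submx_trans QM sM).
- have [s1 s2] : (c *: b <= col_mx (c *: b) Q)%MS /\ (Q <= col_mx (c *: b) Q)%MS.
    by move: (submx_refl (col_mx (c *: b) Q)); rewrite {1}col_mx_sub => /andP[].
  rewrite col_mx_sub; apply/andP; split; last by apply: submx_trans MQ s2.
  have -> : a = c^-1 *: (c *: b) + a *m Q^T *m Q by rewrite scalerA mulVf// scale1r subrK.
  by apply: addmx_sub; [apply: scalemx_sub|apply: submx_trans (submxMl _ _) s2].
Qed.
End Orthonormal.

Section Blockwise.
Variables (R : realType) (n : nat).
Local Notation V := 'rV[R]_(n.+1).
Implicit Types (u v w : V).

(** The linear span of the closed face of [v]. *)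
Definition blockwise v u := forall i j, v ord0 i = v ord0 j -> u ord0 i = u ord0 j.

Lemma coarse_blockwise v u : coarse v u -> blockwise v u.
Proof. by move=> h i j; apply: coarse_eq. Qed.

(** The rows of [P] are the level indicators, a basis of the blockwise vectors; zero sum is the
    kernel of the nonzero column [S] of level sizes and costs one dimension. *)
Lemma blockwise_space v : exists2 M : 'M[R]_(#|reps v|.-1, n.+1), row_free M &
  forall u, (u <= M)%MS <-> blockwise v u /\ \sum_i u ord0 i = 0.
Proof.
pose m := #|reps v|.
pose P : 'M[R]_(m, n.+1) := \matrix_(r, j) (rep v j == enum_val r)%:R.
pose Q : 'M[R]_(n.+1, m) := \matrix_(j, r) (j == enum_val r)%:R.
pose one : 'cV[R]_n.+1 := const_mx 1.
have PQ : P *m Q = 1%:M.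
  apply/matrixP => r r'; rewrite !mxE (bigD1 (enum_val r'))//= big1 ?addr0.
    rewrite !mxE eqxx mulr1 rep_id; last exact: enum_valP.
    by rewrite (inj_eq enum_val_inj) eq_sym.
  by move=> j /negbTE hj; rewrite !mxE hj mulr0.
have fP : row_free P by apply/row_freeP; exists Q.
have PE (y : 'rV_m) : blockwise v (y *m P).
  move=> i j e; rewrite !mxE; apply: eq_bigr => r _; rewrite !mxE.
  by rewrite (rep_eq e).
have EP u : blockwise v u -> u = u *m Q *m P.
  move=> hu; apply/rowP => j; rewrite mxE.
  have hj := rep_in v j.
  have er : enum_val (enum_rank_in hj (rep v j)) = rep v j by rewrite enum_rankK_in.
  rewrite (bigD1 (enum_rank_in hj (rep v j)))//= big1 ?addr0.
    rewrite !mxE er eqxx mulr1 (bigD1 (rep v j))//= big1 ?addr0.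
      by rewrite mxE er eqxx mulr1; apply: hu; rewrite repE.
    by move=> k /negbTE hk; rewrite mxE er hk mulr0.
  move=> r hr; rewrite !mxE; case: eqP => [e|]; last by rewrite mulr0.
  by case/eqP: hr; apply: enum_val_inj; rewrite er e.
have sumE u : \sum_i u ord0 i = (u *m one) ord0 ord0.
  by rewrite mxE; apply: eq_bigr => i _; rewrite mxE mulr1.
pose S := P *m one.
have rS : \rank S = 1%N.
  apply/eqP; rewrite eqn_leq rank_leq_col /= lt0n mxrank_eq0; apply/eqP => S0.
  have hj := rep_in v ord0.
  have : S (enum_rank_in hj (rep v ord0)) ord0 = 0 by rewrite S0 mxE.
  rewrite mxE => /eqP; rewrite psumr_eq0; last by move=> i _; rewrite !mxE mulr1 ler0n.
  move=> /allP /(_ (rep v ord0) (mem_index_enum _)).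
  rewrite /= !mxE enum_rankK_in// mulr1 rep_id// eqxx.
  by rewrite oner_eq0.
have rM : \rank (kermx S *m P) = m.-1.
  by rewrite mxrankMfree// mxrank_ker rS subn1.
have key u : (u <= kermx S *m P)%MS <-> blockwise v u /\ \sum_i u ord0 i = 0.
  split=> [/submxP [D ->]|[hu hs]].
    split; first by rewrite mulmxA; apply: PE.
    have e : D *m (kermx S *m P) *m one = D *m (kermx S *m S) by rewrite [in RHS]/S !mulmxA.
    by rewrite sumE e mulmx_ker mulmx0 mxE.
  rewrite (EP _ hu); apply: submxMr; apply/sub_kermxP.
  rewrite /S mulmxA -(EP _ hu); apply/matrixP => i j; rewrite !ord1 -sumE hs mxE.
  by [].
move: (kermx S *m P) rM key => M rM key.
rewrite -/m -rM; exists (row_base M); first exact: row_base_free.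
by move=> u; rewrite eq_row_base.
Qed.

Lemma blockwise_basis v : exists Q : 'M[R]_(#|reps v|.-1, n.+1), Q *m Q^T = 1%:M /\
  forall u, (u <= Q)%MS <-> blockwise v u /\ \sum_i u ord0 i = 0.
Proof.
case: (blockwise_space v) => M fM hM; case: (exists_orthonormal fM) => Q [QQ QM MQ].
exists Q; split=> // u; split=> [h|/hM h].
  by apply/hM/(submx_trans h).
exact: submx_trans h MQ.
Qed.

Lemma card_reps_gt1 v i j : v ord0 i != v ord0 j -> (1 < #|reps v|)%N.
Proof.
move=> h; have hr : rep v i != rep v j.
  by apply: contra h => /eqP e; rewrite -(repE v i) e repE.
apply: leq_trans (_ : #|[set rep v i; rep v j]| <= _)%N; first by rewrite cards2 hr.
by apply: subset_leq_card; apply/subsetP => k /set2P[] ->; apply: rep_in.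
Qed.
End Blockwise.

(** * The subbuilding *)

Section Subbuilding.
Variables (R : realType) (n : nat) (B : Type) (d : B -> B -> R).
Variable A : set ('rV[R]_(n.+1) -> B).
Hypothesis bld : building_An n d A.
Variable C : set B.
Hypothesis cvxC : convex_subcomplex d A C.
Local Notation V := 'rV[R]_(n.+1).
Local Notation inC := (inC C).
Local Notation generic := (generic A C).
Implicit Types (f g h : V -> B) (u v w : V).

Lemma cone_SA f u : SA n u -> cone f u = (0, 1, Some (f u)).
Proof.
move=> hu; rewrite -(cone_polar f 0 hu ltr01); congr cone.
by apply/rowP => i; rewrite !mxE add0r mul1r.
Qed.

(** [x] and [y] may lie in small faces. Both are enlarged to generic filtrations, to which the frame
    applies; their closed faces, hence [x] and [y], survive the change of chart. *)
Lemma exists_apartment x y : complemented_subcomplex bld cvxC -> C x -> C y ->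
  exists h v ux uy, [/\ generic h v, SA n ux /\ blockwise v ux, SA n uy /\ blockwise v uy,
    h ux = x /\ h uy = y & forall u, blockwise v u -> inC (cone h u)].
Proof.
move=> cplC Cx Cy; case: (exists_generic bld Cx) => g [z gz].
case: (common_chart bld x x) => f1 Af1 [ux [_ [hux _ ex _]]].
case: (common_chart bld y y) => f2 Af2 [uy [_ [huy _ ey _]]].
have Cux : inC (cone f1 ux) by rewrite cone_SA// ex.
have Cuy : inC (cone f2 uy) by rewrite cone_SA// ey.
case: (generic_refine bld cvxC Af1 Cux gz) => h1 [v [gv e1 c1]].
case: (generic_refine bld cvxC Af2 Cuy gz) => h2 [w [gw e2 c2]].
have [[Ah1 _ _] [Ah2 _ mw]] := (gv, gw).
case: (cone_common bld v w Ah1 Ah2) => k Ak [ek [s es]].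
have gkv : generic k v := generic_change Ak (esym ek) gv.
have gkw : generic k (Wact s w).
  split=> //; first by rewrite es; case: gw.
  by move=> g' w' Ag' hw'; rewrite card_reps_Wact; apply: mw hw'.
case: (exists_frame gkv gkw cplC) => h Ah [ehv ehw hb].
have exx : cone h ux = cone f1 ux by rewrite -e1; apply: (cone_face bld Ah Ah1 c1); rewrite ehv.
have eyy : cone h (Wact s uy) = cone f2 uy.
  rewrite -e2 -cone_Wact; apply: (cone_face bld (chart_Wact bld s Ah) Ah2 c2).
  by rewrite cone_Wact ehw.
have hsy : SA n (Wact s uy) by exact: Wact_SA.
exists h, v, ux, (Wact s uy); split=> //.
- exact: generic_change gkv.
- by split=> //; apply: coarse_blockwise.
- split=> // i j e; have cw := coarse_blockwise (@Wact_coarse _ _ s _ _ c2).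
  by apply: cw; apply: (generic_const bld cvxC gkv) e; case: gkw.
- by move: exx eyy; rewrite !cone_SA// ex ey => -[-> [->]].
Qed.

Definition apartment h v : set B := [set b | exists2 u, SA n u /\ blockwise v u & b = h u]%classic.

(** Convexity quantifies over all geodesics; by uniqueness they are great arcs, which are blockwise
    by linearity. *)
Lemma apartment_convex h v : A h -> Defs.convex_set d (apartment h v).
Proof.
move=> Ah x y gam [a [ha ca] ->] [b [hb cb] ->] dab hg _ [t ht <-].
have [e|/eqP nab] := eqVneq a b.
  case: hg => g0 _ _; exists a => //; rewrite -g0; congr gam.
  by move: ht; rewrite /= e (distxx bld) => ?; apply/eqP; rewrite eq_le andbC.
have hL : 0 < sdist a b < pi by rewrite sdist_gt0//= -(chart_isom bld Ah).
exists (great_arc a b t).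
  split; first exact: SA_great_arc.
  by move=> i j e; rewrite /great_arc !mxE (ca _ _ e) (cb _ _ e).
exact: (geodesic_unique bld dab hg (chart_geodesic bld Ah ha hb hL) ht).
Qed.

Lemma apartment_sphere h v k : A h -> #|reps v| = k.+2 -> sphere_dim d (apartment h v) k.
Proof.
move=> Ah hk; case: (blockwise_basis v); rewrite hk /= => Q [QQ hQ].
have dQ (y z : 'rV[R]_k.+1) : dotv (y *m Q) (z *m Q) = dotv y z.
  by rewrite !dotv_mulmx trmx_mul mulmxA -(mulmxA y) QQ mulmx1.
have hSA (y : 'rV[R]_k.+1) : usphere k.+1 y -> SA n (y *m Q) /\ blockwise v (y *m Q).
  have /hQ [h1 h2] : (y *m Q <= Q)%MS by exact: submxMl.
  by move=> hy; split=> //; split=> //; rewrite /usphere /= dQ.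
exists (fun y => h (y *m Q)); split.
  move=> y z /hSA [hy _] /hSA [hz _].
  by rewrite (chart_isom bld)// /sdist dQ.
apply/seteqP; split=> b /=.
  case=> u [hu cu] ->; have /submxP [y ey] : (u <= Q)%MS by apply/hQ; split=> //; case: hu.
  by exists y; rewrite -?ey//; case: hu => hu _; move: hu; rewrite /usphere /= ey dQ.
by case=> y /hSA hy <-; exists (y *m Q).
Qed.

Lemma sphere_dim_ge (s : set B) k : sphere_dim d s k -> (s `<=` C)%classic -> dim_ge d C k.
Proof.
case=> phi [hphi es] sC; exists (delta_mx ord0 ord0), 1, phi; split=> //.
- rewrite /usphere /= /dotv (bigD1 ord0)//= big1 ?addr0; first by rewrite !mxE eqxx mulr1.
  by move=> i /negbTE hi; rewrite !mxE hi andbF mulr0.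
- by move=> x y [hx _] [hy _]; apply: hphi.
- by move=> _ [x [hx _] <-]; apply: sC; rewrite es; exists x.
Qed.

(* Near a point [f u] of [ball] whose coordinates [u] take as many values as possible the
   whole ball is mapped into the face spanned by [u]. *)
Lemma near_face m (ball : set 'rV[R]_m) (phi : 'rV[R]_m -> B) x0 f u :
  (ball `<=` usphere m)%classic ->
  (forall x y, ball x -> ball y -> d (phi x) (phi y) = sdist x y) ->
  ball x0 -> A f -> SA n u -> f u = phi x0 ->
  (forall x g w, ball x -> A g -> SA n w -> g w = phi x -> (#|reps w| <= #|reps u|)%N) ->
  exists2 a : R, a < 1 & forall x, ball x -> a < dotv x x0 ->
    exists w, [/\ SA n w, blockwise u w & f w = phi x].
Proof.
move=> bs iso bx0 Af hu eu hmax; case: (gap u) => g g0 hg.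
(* Then [|w - u|^2 < g ^+ 2 / 4], so coordinates move by less than half the gap and [w] keeps the
   strict inequalities of [u]; maximality of the number of values gives the equalities. *)
exists (1 - g ^+ 2 / 8); first by rewrite gtrBl divr_gt0// exprn_gt0.
move=> x bx hx.
case: (common_chart bld (phi x) (phi x)) => f1 Af1 [w1 [_ [hw1 _ e1 _]]].
case: (cone_common bld u w1 Af Af1) => h Ah [eh [s es]].
have hw : SA n (Wact s w1) by exact: Wact_SA.
have ehu : h u = f u by move: eh; rewrite !cone_SA// => -[].
have ehw : h (Wact s w1) = phi x by move: es; rewrite !cone_SA// e1 => -[].
move: (Wact s w1) hw ehw => w hw ehw.
have [hu1 _] := hu; have [hw1' _] := hw.
have dwu : dotv w u = dotv x x0.
  rewrite -!cos_sdist//; [|exact: bs|exact: bs].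
  by rewrite -(chart_isom bld Ah)// -iso// ehu ehw eu.
have close i : `|w ord0 i - u ord0 i| < g / 2.
  have : (w ord0 i - u ord0 i) ^+ 2 <= dotv (w - u) (w - u).
    rewrite /dotv (bigD1 i)//= !mxE -expr2 lerDl; apply: sumr_ge0 => k _.
    by rewrite -expr2 sqr_ge0.
  have -> : w - u = w + (-1) *: u by rewrite scaleN1r.
  rewrite !(dotvDl, dotvDr, dotvZl, dotvZr) (dotvC u w) dwu hu1 hw1' => h1.
  have : (w ord0 i - u ord0 i) ^+ 2 < (g / 2) ^+ 2.
    by apply: le_lt_trans h1 _; rewrite expr_div_n; move: hx; lra.
  rewrite -[ltLHS]real_normK ?num_real// ltr_sqr ?nnegrE//.
  by rewrite divr_ge0// ltW.
have lt_uw i j : u ord0 i < u ord0 j -> w ord0 i < w ord0 j.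
  move=> /hg h1; have := close i; have := close j; rewrite !ltr_norml.
  by move=> /andP[? ?] /andP[? ?]; lra.
have eq_wu i j : w ord0 i = w ord0 j -> u ord0 i = u ord0 j.
  by case: (ltgtP (u ord0 i) (u ord0 j)) => // /lt_uw h1 h2; move: h1; rewrite h2 ltxx.
have eq_uw := card_reps_eq eq_wu (hmax _ _ _ bx Ah hw ehw).
exists w; split=> //; rewrite -ehw.
apply: (chart_face bld Af Ah hu hw (esym ehu)) => i j.
by rewrite le_eqVlt => /orP[/eqP/eq_uw ->//|/lt_uw/ltW].
Qed.

(** Room for moving [x0] in every coordinate direction, in order to find a basis of unit vectors
    near it. *)
Lemma perturb_unit m (x0 : 'rV[R]_m) (z : 'rV[R]_m) (a : R) :
  usphere m x0 -> usphere m z -> a < dotv x0 z ->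
  exists2 e : R, 0 < e & forall t (i : 'I_m), `|t| < e ->
    let y := x0 + t *: delta_mx ord0 i in
    0 < dotv y y /\ a < dotv ((Num.sqrt (dotv y y))^-1 *: y) z.
Proof.
move=> hx hz ha.
have coord (u : 'rV[R]_m) i : usphere m u -> `|u ord0 i| <= 1.
  move=> hu; have : u ord0 i ^+ 2 <= dotv u u.
    rewrite /dotv (bigD1 i)//= -expr2 lerDl; apply: sumr_ge0 => k _.
    by rewrite -expr2 sqr_ge0.
  rewrite hu => h; rewrite -ler_sqr ?nnegrE// expr1n.
  by rewrite real_normK ?num_real.
have ddelta (u : 'rV[R]_m) i : dotv (delta_mx ord0 i) u = u ord0 i.
  rewrite /dotv (bigD1 i)//= big1 ?addr0; first by rewrite !mxE !eqxx mul1r.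
  by move=> k /negbTE hk; rewrite !mxE hk andbF mul0r.
(* The norm of [y] is within [|t|] of 1 and [dotv y z] within [|t|] of [dotv x0 z], so
   [(1 + |a|) * |t| < dotv x0 z - a] suffices. *)
pose D := 1 + `|a|; have D0 : 0 < D by rewrite /D ltr_pwDl.
pose e := Order.min (1 / 2) ((dotv x0 z - a) / D).
have e0 : 0 < e by rewrite lt_min !divr_gt0// subr_gt0.
exists e => // t i; rewrite /e lt_min => /andP[t1 t2] /=; set y := x0 + _.
rewrite ltr_pdivlMr// in t2.
have ey : dotv y y = 1 + 2 * t * x0 ord0 i + t ^+ 2.
  rewrite /y !(dotvDl, dotvDr, dotvZl, dotvZr) (dotvC x0 (delta_mx _ _)) !ddelta hx mxE !eqxx /=.
  by ring.
have := coord x0 i hx; have := coord z i hz; rewrite !ler_norml => /andP[z1 z2] /andP[x1 x2].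
have tt : t ^+ 2 = `|t| ^+ 2 by rewrite real_normK ?num_real.
have tx : - `|t| <= t * x0 ord0 i <= `|t|.
  by rewrite -ler_norml normrM ler_piMr// ler_norml x1 x2.
have tz : - `|t| <= t * z ord0 i.
  have : `|t * z ord0 i| <= `|t| by rewrite normrM ler_piMr// ler_norml z1 z2.
  by rewrite ler_norml => /andP[].
have t0 : 0 <= `|t| by exact: normr_ge0.
case/andP: tx => tx1 tx2.
have lo : (1 - `|t|) ^+ 2 <= dotv y y by rewrite ey tt; lra.
have hi : dotv y y <= (1 + `|t|) ^+ 2 by rewrite ey tt; lra.
have y0 : 0 < dotv y y by apply: lt_le_trans lo; rewrite exprn_gt0//; lra.
split=> //; have r0 : 0 < Num.sqrt (dotv y y) by rewrite sqrtr_gt0.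
have rlo : 1 - `|t| <= Num.sqrt (dotv y y).
  by rewrite -ler_sqr ?nnegrE ?sqrtr_ge0 ?sqr_sqrtr ?dotv_ge0//; lra.
have rhi : Num.sqrt (dotv y y) <= 1 + `|t|.
  by rewrite -ler_sqr ?nnegrE ?sqrtr_ge0 ?sqr_sqrtr ?dotv_ge0//; lra.
have eyz : dotv y z = dotv x0 z + t * z ord0 i by rewrite /y dotvDl dotvZl ddelta.
rewrite dotvZl mulrC ltr_pdivlMr// eyz.
apply: le_lt_trans (_ : a + `|a| * `|t| < _); last by rewrite /D in t2; lra.
have [a0|a0] := leP 0 a.
  rewrite (ger0_norm a0) -{2}[a]mulr1 -mulrDr; exact: ler_wpM2l.
have -> : a + `|a| * `|t| = a * (1 - `|t|) by rewrite ltr0_norm//; ring.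
by apply: ler_wnM2l => //; apply: ltW.
Qed.

(* A ball in C of dimension k would give k+1 unit vectors with invertible Gram matrix in the
   span of one face. *)
Lemma dim_ge_bound f v k : generic f v -> dim_ge d C k -> (k.+1 < #|reps v|)%N.
Proof.
move=> [_ _ hm] [c [e [phi]]] /=.
set ball : set 'rV[R]_k.+1 := [set x | _]%classic => -[e0 hc iso sub].
have bs : (ball `<=` usphere k.+1)%classic by move=> x [].
pose P m := exists x g w, [/\ ball x, A g, SA n w, g w = phi x & #|reps w| = m].
have bc : ball c by split=> //; rewrite sdistxx.
have P0 : exists m, P m.
  case: (common_chart bld (phi c) (phi c)) => g Ag [w [_ [hw _ ew _]]].
  by exists #|reps w|, c, g, w.
case: P0 => m0 P0.
have [|m [x0 [g [u [bx0 Ag hu eu em]]]] hmax] := exists_max_nat (N := n.+1) P0.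
  by move=> m [x [g [w [_ _ _ _ <-]]]]; rewrite -[X in (_ <= X)%N]card_ord max_card.
have uv : (#|reps u| <= #|reps v|)%N.
  apply: (hm g) => //; rewrite cone_SA// eu; apply: sub; by exists x0.
apply: (leq_trans _ uv).
have [|a a1 ha] := near_face bs iso bx0 Ag hu eu.
  by move=> x g' w bx Ag' hw ew; rewrite em; apply: hmax; exists x, g', w.
have hx0 : usphere k.+1 x0 by exact: bs.
have [b b1 hb] : exists2 b : R, b < dotv x0 c & forall x, usphere k.+1 x -> b < dotv x c -> ball x.
  have [ep|pe] := leP e pi; last first.
    (* A radius above [pi] gives the whole sphere. *)
    exists (-2); first by have := unit_dotv_bounds hx0 hc => /andP[]; lra.
    move=> x hx _; split=> //; apply: le_lt_trans pe.
    by case/andP: (sdist_bounds hx hc).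
  have he : e \in `[0, pi]%R by rewrite in_itv /= ep ltW.
  exists (cos e).
    rewrite -cos_sdist// ltr_cos//; first by case: bx0.
    by rewrite in_itv/= sdist_bounds.
  by move=> x hx; rewrite -cos_sdist// ltr_cos// ?in_itv/= ?sdist_bounds.
have [e1 e10 he1] := perturb_unit hx0 hc b1.
have a2 : a < dotv x0 x0 by rewrite (hx0 : dotv x0 x0 = 1).
have [e2 e20 he2] := perturb_unit hx0 hx0 a2.
(* The rows [y i] below form [t] times the identity plus a rank one matrix, invertible when [t] and
   [t + \sum_i x0 ord0 i] are nonzero; hence [t] gets the sign of the sum. *)
pose sg : R := if 0 <= \sum_i x0 ord0 i then 1 else -1.
pose t := sg * (Order.min e1 e2 / 2).
have em0 : 0 < Order.min e1 e2 by rewrite lt_min e10.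
have sg1 : `|sg| = 1 by rewrite /sg; case: ifP => _; rewrite ?normrN1 ?normr1.
have tn : `|t| = Order.min e1 e2 / 2.
  by rewrite /t normrM sg1 mul1r ger0_norm// divr_ge0// ltW.
have th : `|t| < Order.min e1 e2 by rewrite tn; lra.
have [t1 t2] : `|t| < e1 /\ `|t| < e2 by move: th; rewrite lt_min => /andP[].
have t0 : t + \sum_i x0 ord0 i != 0.
  apply/eqP; rewrite /t /sg; case: ifPn => hs; last rewrite -ltNge in hs.
    by rewrite mul1r; lra.
  by rewrite mulN1r; lra.
have tn0 : t != 0 by rewrite -normr_gt0 tn; lra.
pose y i := x0 + t *: delta_mx ord0 i.
pose r i := Num.sqrt (dotv (y i) (y i)).
pose x i := (r i)^-1 *: y i.
have r0 i : 0 < r i by rewrite sqrtr_gt0; case: (he1 t i t1).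
have hx i : usphere k.+1 (x i).
  rewrite /usphere /= /x dotvZl dotvZr mulrA -(sqr_sqrtr (dotv_ge0 (y i))) -/(r i).
  by rewrite -expr2 -exprMn mulVf ?expr1n// gt_eqF.
have bx i : ball (x i) by apply: hb => //; case: (he1 t i t1).
have : forall i, exists w, [/\ SA n w, blockwise u w & g w = phi (x i)].
  by move=> i; apply: ha => //; case: (he2 t i t2).
move=> /choice [w hw].
pose T : 'M[R]_k.+1 := \matrix_(i, j) x i ord0 j.
pose W : 'M[R]_(k.+1, n.+1) := \matrix_(i, j) w i ord0 j.
have rT i : row i T = x i by apply/rowP => j; rewrite !mxE.
have rW i : row i W = w i by apply/rowP => j; rewrite !mxE.
(* Isometry gives both families the same Gram matrix, so [W] inherits independence from [T]. *)
have TW : T *m T^T = W *m W^T.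
  apply/matrixP => i j.
  have -> : (T *m T^T) i j = dotv (x i) (x j) by rewrite mxE; apply: eq_bigr => l _; rewrite !mxE.
  have -> : (W *m W^T) i j = dotv (w i) (w j) by rewrite mxE; apply: eq_bigr => l _; rewrite !mxE.
  case: (hw i) => hi _ ei; case: (hw j) => hj _ ej; have [hi1 _] := hi; have [hj1 _] := hj.
  have e4 : sdist (x i) (x j) = sdist (w i) (w j).
    by rewrite -(iso _ _ (bx i) (bx j)) -ei -ej (chart_isom bld).
  by rewrite -(cos_sdist (hx i) (hx j)) e4 cos_sdist.
have fT : forall z : 'rV[R]_k.+1, z *m T = 0 -> z = 0.
  move=> z hz; pose z' : 'rV[R]_k.+1 := \row_i (z ord0 i / r i).
  have e3 j : (\sum_i z' ord0 i) * x0 ord0 j + t * z' ord0 j = 0.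
    have e5 : (z *m T) ord0 j = 0 by rewrite hz mxE.
    rewrite -[RHS]e5 [RHS]mxE mulr_suml.
    transitivity (\sum_i (z' ord0 i * x0 ord0 j + t * (z' ord0 i * (j == i)%:R))).
      rewrite big_split /= -mulr_sumr; congr (_ + _ * _).
      rewrite (bigD1 j)//= big1 ?addr0 ?eqxx ?mulr1// => i /negbTE ij.
      by rewrite eq_sym ij mulr0.
    by apply: eq_bigr => i _; rewrite !mxE eqxx /=; ring.
  pose S := \sum_i z' ord0 i.
  have S0 : S * (t + \sum_j x0 ord0 j) = 0.
    have : \sum_j (S * x0 ord0 j + t * z' ord0 j) = 0 by rewrite big1// => j _; apply: e3.
    by rewrite big_split /= -!mulr_sumr -/S mulrDr addrC (mulrC S t).
  have {}S0 : S = 0 by move/eqP: S0; rewrite mulf_eq0 (negbTE t0) orbF => /eqP.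
  apply/rowP => i; rewrite mxE; have := e3 i; rewrite -/S S0 mul0r add0r => /eqP.
  rewrite mulf_eq0 (negbTE tn0) /= mxE mulf_eq0 invr_eq0 (gt_eqF (r0 i)) orbF.
  by move/eqP.
have fW : row_free W.
  apply: inj_row_free => z hz; apply: fT; apply: dotv_eq0.
  by rewrite dotv_mulmx trmx_mul mulmxA -(mulmxA z) TW mulmxA hz !mul0mx mxE.
case: (blockwise_space u) => M _ hM.
have WM : (W <= M)%MS.
  by apply/row_subP => i; rewrite rW; apply/hM; case: (hw i) => -[_ hi] bi _.
have h1 : (k.+1 <= #|reps u|.-1)%N.
  rewrite -(eqP fW); apply: leq_trans (mxrankS WM) _; exact: rank_leq_row.
by case: #|reps u| h1.
Qed.

(** The generic [v] depends on the pair of points, but its number of values, being maximal, does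
    not. The dimension is two less: one for the constants, one for passing to the unit sphere. *)
Lemma complemented_subbuilding : complemented_subcomplex bld cvxC -> subbuilding d C.
Proof.
move=> cplC; split; first by case: cvxC.
move=> x y Cx Cy.
case: (exists_apartment cplC Cx Cy) => h [v [ux [uy [gv [hux bux] [huy buy] [ex ey] hC]]]].
have [Ah _ _] := gv.
have v2 : (1 < #|reps v|)%N.
  case: (SA_lt hux) => i [j ij]; apply: (card_reps_gt1 (i := i) (j := j)).
  by apply/eqP => /bux e; move: ij; rewrite e ltxx.
have [k hk] : exists k, #|reps v| = k.+2 by case: (#|reps v|) v2 => [|[|k]]// _; exists k.
have hs := apartment_sphere Ah hk.
have sC : (apartment h v `<=` C)%classic.
  by move=> _ [u [hu bu] ->]; have := hC _ bu; rewrite cone_SA.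
exists (apartment h v), k; split=> //.
- exact: apartment_convex.
- by split; [exists ux|exists uy].
- split; first exact: sphere_dim_ge hs sC.
  by move=> /(dim_ge_bound gv); rewrite hk ltnn.
Qed.
End Subbuilding.

Theorem theorem4p2 (R : realType) (n : nat) (B : Type) (d : B -> B -> R)
    (A : set ('rV[R]_(n.+1) -> B)) (C : set B) :
  (1 <= n)%N ->
  building_An n d A ->
  convex_subcomplex d A C ->
  subbuilding d C \/ (circumradius d C <= (pi / 2)%:E)%E.
Proof.
move=> _ bld cvxC.
have [cpl|ncpl] := pselect (complemented_subcomplex bld cvxC).
  by left; apply: complemented_subbuilding cpl.
(* The empty set has circumradius [+oo], but it is vacuously a subbuilding. *)
have [[x Cx]|nC] := pselect (exists x, C x); last first.
  by left; split; [have [] := cvxC|move=> x y Cx; case: nC; exists x].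
by right; apply: circumradius_le_pihalf Cx ncpl.
Qed.
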